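(* Let $d>2$, $\Omega\subseteq\mathbb{R}^d$ open, and $2\le k\le d-1$ an odd integer. Let $f\in W^{1,\infty}(\Omega,\mathbb{R}^d)$ and suppose that the a.e.-defined map $x\mapsto\bigwedge^kdf_x$ has a smooth representative $\Omega\to\operatorname{End}(\bigwedge^k\mathbb{R}^d)$ taking values in $\tilde H_{>k}$ at every point. Then $f$ is smooth.
   Context: $\bigwedge^kA$ is the endomorphism of $\bigwedge^k\mathbb{R}^d$ given by $v_1\wedge\dots\wedge v_k\mapsto Av_1\wedge\dots\wedge Av_k$. $\tilde H_{>k}=\{B\in\operatorname{End}(\bigwedge^k\mathbb{R}^d):\operatorname{rank}B>k\}$. *)

(* Defs.v *)
From HB Require Import structures.
From mathcomp Require Import all_boot all_order all_algebra.
From mathcomp Require Import all_classical all_reals all_analysis.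
Set Implicit Arguments. Unset Strict Implicit. Unset Printing Implicit Defensive.
Import Order.TTheory GRing.Theory Num.Theory.
Import numFieldNormedType.Exports.
Local Open Scope classical_set_scope.
Local Open Scope ring_scope.

Definition ebasis (R : realType) (d : nat) (i : 'I_d) : 'rV[R]_d := delta_mx 0 i.

Fixpoint pder (R : realType) (d : nat) (V : normedModType R) (l : seq 'I_d)
  (f : 'rV[R]_d -> V) : 'rV[R]_d -> V :=
  match l with
  | [::] => f
  | i :: l' => fun x => 'D_(ebasis R i) (pder l' f) x
  end.

Definition smooth_on (R : realType) (d : nat) (V : normedModType R)
  (O : set 'rV[R]_d) (f : 'rV[R]_d -> V) : Prop :=
  forall l : seq 'I_d,
    (forall x, O x -> {for x, continuous (pder l f)}) /\
    (forall (i : 'I_d) x, O x -> derivable (pder l f) x (ebasis R i)).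

Definition Rd (R : realType) (d : nat) := g_sigma_algebraType (@open 'rV[R]_d).

(** mu is (the Borel restriction of) Lebesgue measure on R^d: it gives every
    half-open box its volume.  Such a measure exists and is unique. *)
Definition is_lebesgue (R : realType) (d : nat)
  (mu : {measure set (Rd R d) -> \bar R}) : Prop :=
  forall a b : 'rV[R]_d, (forall i, a 0 i <= b 0 i) ->
    mu [set x : Rd R d | forall i, a 0 i < (x : 'rV[R]_d) 0 i <= b 0 i]
    = (\prod_(i < d) (b 0 i - a 0 i))%:E.

Definition test_fun (R : realType) (d : nat) (O : set 'rV[R]_d)
  (phi : 'rV[R]_d -> R) : Prop :=
  smooth_on [set: 'rV[R]_d] phi /\
  exists K : set 'rV[R]_d, [/\ compact K, K `<=` O &
                              forall x, ~ K x -> phi x = 0].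

Definition Linf (R : realType) (d : nat) (mu : {measure set (Rd R d) -> \bar R})
  (O : set 'rV[R]_d) (h : 'rV[R]_d -> R) : Prop :=
  measurable_fun (O : set (Rd R d)) (h : Rd R d -> R) /\
  exists M : R, {ae mu, forall x : Rd R d, O x -> `|h x| <= M}.

(** G is a weak differential of f : O -> R^d in L^infinity, in the row-vector
    convention: G x i j is the weak partial derivative d_i f_j, so that
    df_x (v) = v *m G x.
    Weak derivative: int_O f_j d_i phi = - int_O G_{ij} phi for all test phi. *)
Definition weak_diff (R : realType) (d : nat) (mu : {measure set (Rd R d) -> \bar R})
  (O : set 'rV[R]_d) (f : 'rV[R]_d -> 'rV[R]_d) (G : 'rV[R]_d -> 'M[R]_d) : Prop :=
  (forall i j, Linf mu O (fun x => G x i j)) /\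
  forall phi, test_fun O phi -> forall i j : 'I_d,
    (\int[mu]_(x in (O : set (Rd R d)))
        ((f x 0 j) * 'D_(ebasis R i) phi x)%:E =
     - \int[mu]_(x in (O : set (Rd R d))) ((G x i j) * phi x)%:E)%E.

Definition W1inf_with_diff (R : realType) (d : nat)
  (mu : {measure set (Rd R d) -> \bar R}) (O : set 'rV[R]_d)
  (f : 'rV[R]_d -> 'rV[R]_d) (G : 'rV[R]_d -> 'M[R]_d) : Prop :=
  (forall j, Linf mu O (fun x => f x 0 j)) /\ weak_diff mu O f G.

(** k-element subsets of {0,..,d-1}: they index the standard basis
    e_I = e_{i_1} /\ ... /\ e_{i_k} (i_1 < ... < i_k) of /\^k R^d. *)
Definition kset (d k : nat) := {I : {set 'I_d} | #|I| == k}.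

Definition dimext (d k : nat) := #|{: kset d k}|.

Definition kelt (d k : nat) (I : kset d k) (p : 'I_k) : 'I_d :=
  @enum_val _ (mem (val I)) (cast_ord (esym (eqP (valP I))) p).

(** Matrix of /\^k A on /\^k R^d in the basis (e_I)_I, for A acting on row
    vectors (v |-> v *m A): the entry (I,J) is the minor det A[I,J]
    (the k-th compound matrix). *)
Definition extpow (R : realType) (d k : nat) (A : 'M[R]_d) : 'M[R]_(dimext d k) :=
  \matrix_(p, q)
    \det (\matrix_(a < k, b < k)
            A (kelt (enum_val p) a) (kelt (enum_val q) b)).

Definition Htilde_gt (R : realType) (d k : nat) (B : 'M[R]_(dimext d k)) : bool :=
  (k < \rank B)%N.

(* Main.v *)
Require Import Defs.
From HB Require Import structures.
From mathcomp Require Import all_boot all_order all_algebra.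
From mathcomp Require Import all_classical all_reals all_analysis.
From mathcomp Require Import perm measurable_realfun ring lra.
Set Implicit Arguments. Unset Strict Implicit. Unset Printing Implicit Defensive.
Import Order.TTheory GRing.Theory Num.Theory.
Import numFieldNormedType.Exports.
Local Open Scope classical_set_scope.
Local Open Scope ring_scope.

(** Algebra: if M is a square matrix of size k + 1, the compound of order k of M is,
    up to signs, adj M, and det (adj M) = (det M)^k.  As k is odd, det M is a smooth
    function of adj M near an invertible M, and then so is M = det M (adj M)^-1.
    Applied to the compressions U A V of a matrix A of rank > k to size k + 1
    (whose minors are linear in the compound of A by Cauchy-Binet), this makes A
    locally a smooth function of its compound of order k.  Since the weak
    differential is bounded, every F x is the compound of some matrix A x, by
    compactness; A is smooth and agrees almost everywhere with the weak
    differential.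

    Analysis: a bounded function f whose weak partial derivatives are bounded and
    continuous is C^1 up to a null set.  Testing against smooth approximations of
    the product of a trapezoid in x_i and an interval indicator in the other
    coordinates compares the averages of f over two boxes which differ only in
    coordinate i.  So the averages over boxes shrinking to x converge to some g x
    at a rate linear in the side lengths, and g has the prescribed partial
    derivatives.  Moreover the integral of f - g over a box is at most a constant
    times the sum of the sides times the volume; bisecting repeatedly, it
    vanishes, so f = g almost everywhere. *)

(** * Functions of class C^n *)

(** Both hypotheses on the compound have a precise job. A matrix of rank at most k factors through
    R^k, whose k-th exterior power is a line, so its compound has rank at most 1; the lower bound on
    the rank of [F x] therefore forces rank A > k, and some compression of A to size k + 1 is
    invertible. Oddness of k makes the k-th root of (det M)^k unique, sign included; for even k, M
    and -M have the same adjugate. The identity between [F] and the compound of the weak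
    differential holds only almost everywhere, while the local inversion needs a matrix above every
    point. Sets of full measure are dense, which is what the compactness argument exploits. The
    measure is given only through the volumes of half-open boxes. Hence the integrals that are
    evaluated exactly are those of constants and of box indicators, everything else is an estimate
    or a dominated limit, and averages over boxes do the work of convolutions. *)

Section SmoothCalculus.
Variables (R : realType) (X : normedModType R) (I : Type) (e : I -> X).

(* Derivatives are existential witnesses rather than iterated 'D_v, so that
   closure properties need no rewriting of derivatives. *)
Fixpoint Cn (n : nat) (U : set X) (f : X -> R) : Prop :=
  (forall x, U x -> {for x, continuous f}) /\
  if n is m.+1 then
    forall i, exists f' : X -> R,
      (forall x, U x -> is_derive x (e i) f (f' x)) /\ Cn m U f'
  else True.

Lemma Cn_continuous n U f : Cn n U f -> forall x, U x -> {for x, continuous f}.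
Proof. by case: n => [|n] []. Qed.

Lemma Cn_sub n U V f : V `<=` U -> Cn n U f -> Cn n V f.
Proof.
move=> VU; elim: n f => [|n IH] f /= [cf df]; split => //.
- by move=> x /VU; exact: cf.
- by move=> x /VU; exact: cf.
- move=> i; have [f' [f'd f'n]] := df i; exists f'; split; last exact: IH.
  by move=> x /VU; exact: f'd.
Qed.

Lemma CnW n U f : Cn n.+1 U f -> Cn n U f.
Proof.
elim: n f => [|n IH] f [cf df]; split => // i.
have [f' [f'd f'n]] := df i; exists f'; split => //; exact: IH.
Qed.

Lemma continuous_eq_open (V : topologicalType) (U : set X) (f g : X -> V) x : open U -> U x ->
  (forall x, U x -> f x = g x) -> {for x, continuous f} -> {for x, continuous g}.
Proof.
move=> oU Ux fg cf; suff : g @ x --> g x by [].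
rewrite -(fg _ Ux); apply: cvg_trans (cf : f @ x --> f x).
apply: near_eq_cvg; near=> y; apply: fg.
by near: y; exact: open_nbhs_nbhs.
Unshelve. all: by end_near. Qed.

Lemma Cn_eq n U f g : open U -> (forall x, U x -> f x = g x) ->
  Cn n U f -> Cn n U g.
Proof.
move=> oU fg Hf.
have cg x : U x -> {for x, continuous g}.
  by move=> Ux; apply: continuous_eq_open fg _ => //; exact: (Cn_continuous Hf).
case: n Hf => [//|n] [_ df]; split => // i.
have [f' [f'd f'n]] := df i; exists f'; split => // x Ux.
apply: near_eq_is_derive (f'd _ Ux).
by near=> y; apply: fg; near: y; exact: open_nbhs_nbhs.
Unshelve. all: by end_near. Qed.

Lemma Cn_local n U f :
  (forall x, U x -> exists2 W, open W /\ W x & Cn n W f) -> Cn n U f.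
Proof.
elim: n f => [|n IH] f loc; split => //.
- by move=> x /loc[W [_ Wx]] /Cn_continuous; apply.
- by move=> x /loc[W [_ Wx]] /Cn_continuous; apply.
(* The witnesses given by the various W are unrelated outside their own W; the directional
   derivative is a global choice that agrees with each of them where it matters. *)
- move=> i; exists (fun x => 'D_(e i) f x); split.
    move=> x /loc[W [_ Wx]] [_ /(_ i)[f' [f'd _]]].
    by apply: derivableP; case: (f'd _ Wx).
  apply: IH => x /loc[W [oW Wx]] [_ /(_ i)[f' [f'd f'n]]]; exists W => //.
  by apply: Cn_eq f'n => // y /f'd[_ ->].
Qed.

Lemma Cn_cst n U c : Cn n U (fun=> c).
Proof.
elim: n c => [|n IH] c; split => //.
- by move=> x _; exact: cst_continuous.
- by move=> x _; exact: cst_continuous.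
- move=> i; exists (fun=> 0); split; last exact: IH.
  by move=> x _; exact: is_derive_cst.
Qed.

Lemma Cn_add n U f g : Cn n U f -> Cn n U g -> Cn n U (fun x => f x + g x).
Proof.
elim: n f g => [|n IH] f g [cf df] [cg dg]; split => //.
- by move=> x Ux; apply: continuousD; [exact: cf|exact: cg].
- by move=> x Ux; apply: continuousD; [exact: cf|exact: cg].
- move=> i; have [f' [f'd f'n]] := df i; have [g' [g'd g'n]] := dg i.
  exists (fun x => f' x + g' x); split; last exact: IH.
  by move=> x Ux; apply: is_deriveD; [exact: f'd|exact: g'd].
Qed.

Lemma Cn_mul n U f g : Cn n U f -> Cn n U g -> Cn n U (fun x => f x * g x).
Proof.
elim: n f g => [|n IH] f g Hf Hg; have [cf df] := Hf; have [cg dg] := Hg; split => //.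
- by move=> x Ux; apply: continuousM; [exact: cf|exact: cg].
- by move=> x Ux; apply: continuousM; [exact: cf|exact: cg].
- move=> i; have [f' [f'd f'n]] := df i; have [g' [g'd g'n]] := dg i.
  exists (fun x => f x * g' x + g x * f' x); split.
    by move=> x Ux; apply: is_deriveM; [exact: f'd|exact: g'd].
  by apply: Cn_add; apply: IH => //; exact: CnW.
Qed.

Lemma Cn_sum n U (J : Type) (r : seq J) (P : pred J) (F : J -> X -> R) :
  (forall j, Cn n U (F j)) -> Cn n U (fun x => \sum_(j <- r | P j) F j x).
Proof.
move=> HF; elim: r => [|j r IH].
  by under eq_fun do rewrite big_nil; exact: Cn_cst.
under eq_fun do rewrite big_cons.
by case: (P j) => //; apply: Cn_add.
Qed.

Lemma Cn_prod n U (J : Type) (r : seq J) (P : pred J) (F : J -> X -> R) :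
  (forall j, Cn n U (F j)) -> Cn n U (fun x => \prod_(j <- r | P j) F j x).
Proof.
move=> HF; elim: r => [|j r IH].
  by under eq_fun do rewrite big_nil; exact: Cn_cst.
under eq_fun do rewrite big_cons.
by case: (P j) => //; apply: Cn_mul.
Qed.

Lemma Cn_inv n U f : (forall x, U x -> f x != 0) -> Cn n U f ->
  Cn n U (fun x => (f x)^-1).
Proof.
move=> f0; elim: n f f0 => [|n IH] f f0 Hf; have [cf df] := Hf; split => //.
- by move=> x Ux; apply: (@continuousV _ _ f); [exact: f0|exact: cf].
- by move=> x Ux; apply: (@continuousV _ _ f); [exact: f0|exact: cf].
- move=> i; have [f' [f'd f'n]] := df i.
  exists (fun x => (-1) * ((f x)^-1 * (f x)^-1) * f' x); split.
    move=> x Ux; have [d1 d2] := f'd _ Ux.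
    apply: DeriveDef; first by apply: derivableV => //; exact: f0.
    rewrite deriveV//; last exact: f0.
    by rewrite d2 -exprVn expr2 /GRing.scale/= mulN1r.
  have fV : Cn n U (fun x => (f x)^-1) by apply: IH => //; exact: CnW.
  apply: Cn_mul => //; apply: Cn_mul; first exact: Cn_cst.
  exact: Cn_mul.
Qed.

Lemma Cn_det n U m (M : X -> 'M[R]_m) :
  (forall i j, Cn n U (fun x => M x i j)) -> Cn n U (fun x => \det (M x)).
Proof.
move=> HM; rewrite /determinant; apply: Cn_sum => s.
by apply: Cn_mul; [exact: Cn_cst|exact: Cn_prod].
Qed.

Lemma Cn_adj n U m (M : X -> 'M[R]_m) i j :
  (forall i j, Cn n U (fun x => M x i j)) -> Cn n U (fun x => (\adj (M x)) i j).
Proof.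
move=> HM; under eq_fun do rewrite mxE /cofactor.
apply: Cn_mul; first exact: Cn_cst.
by apply: Cn_det => a b; under eq_fun do rewrite !mxE.
Qed.

End SmoothCalculus.

Definition Cn1 (R : realType) := @Cn R R unit (fun=> 1).

(** Only the derivative of h along v is assumed, not differentiability. Restricting h to the line
    through x in direction v gives a function of one real variable, for which the two notions agree
    and the usual chain rule applies. *)
Lemma is_derive_comp1 (R : realType) (X : normedModType R) (h : X -> R) (phi : R -> R)
  (x v : X) (dh dphi : R) :
  is_derive x v h dh -> is_derive (h x) 1 phi dphi ->
  is_derive x v (fun y => phi (h y)) (dphi * dh).
Proof.
move=> [dhx hE] [dp pE].
have line (k : X -> R) : derivable k x v <-> derivable (fun t : R => k (t *: v + x)) 0 1.
  exact: derivable1P.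
have lineD (k : X -> R) : 'D_v k x = 'D_1 (fun t : R => k (t *: v + x)) 0.
  rewrite /derive; set g1 := fun h => h^-1 *: _; set g2 := fun h => h^-1 *: _.
  suff -> : g1 = g2 by []; apply/funext => t; rewrite /g1 /g2 /=.
  by rewrite addr0 scale0r add0r [_%:A]mulr1.
pose hl (t : R) := h (t *: v + x).
have d1 : derivable hl 0 1 := (line h).1 dhx.
have hl0 : hl 0 = h x by rewrite /hl scale0r add0r.
have d2 : derivable phi (hl 0) 1 by rewrite hl0.
have D1 : derive1 hl 0 = dh by rewrite derive1E -hE lineD.
have D2 : derive1 phi (hl 0) = dphi by rewrite derive1E hl0.
have cE : derive1 (phi \o hl) 0 = dphi * dh by rewrite derive1_comp// D1 D2.
have dc : derivable (phi \o hl) 0 1.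
  by apply/derivable1_diffP/differentiable_comp; apply/derivable1_diffP.
apply: DeriveDef; first exact/line.
by rewrite lineD -[LHS](derive1E (phi \o hl)).
Qed.

Lemma Cn_comp (R : realType) (X : normedModType R) (I : Type) (e : I -> X) n
  (T : set R) (U : set X) (phi : R -> R) (h : X -> R) :
  (forall x, U x -> T (h x)) -> Cn1 n T phi -> Cn e n U h ->
  Cn e n U (fun x => phi (h x)).
Proof.
move=> UT; elim: n phi h UT => [|n IH] phi h UT Hp Hh; have [cp dp] := Hp;
  have [ch dh] := Hh; split => //.
- move=> x Ux; apply: (@continuous_comp _ _ _ h phi); first exact: ch.
  by apply: cp; exact: UT.
- move=> x Ux; apply: (@continuous_comp _ _ _ h phi); first exact: ch.
  by apply: cp; exact: UT.
- move=> i; have [h' [h'd h'n]] := dh i; have [p' [p'd p'n]] := dp tt.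
  exists (fun x => p' (h x) * h' x); split.
    move=> x Ux; apply: is_derive_comp1; first exact: h'd.
    by apply: p'd; exact: UT.
  apply: Cn_mul => //; apply: IH => //; exact: CnW.
Qed.

Lemma Cn1_id (R : realType) n (U : set R) : Cn1 n U (@id R).
Proof.
case: n => [|n]; split => //; [by move=> x _; exact: cvg_id | by move=> x _; exact: cvg_id |].
move=> i; exists (fun=> 1); split; last exact: Cn_cst.
by move=> x _; exact: is_derive_id.
Qed.

Lemma Cn1_expR (R : realType) n (U : set R) : Cn1 n U (@expR R).
Proof.
elim: n => [|n IH]; split => //; [by move=> x _; exact: continuous_expR | by move=> x _; exact: continuous_expR |].
by move=> i; exists expR; split => // x _; exact: is_derive_expR.
Qed.

Lemma Cn1_ln (R : realType) n : Cn1 n [set x : R | 0 < x] (@ln R).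
Proof.
case: n => [|n]; split => //; [by move=> x; exact: continuous_ln | by move=> x; exact: continuous_ln |].
move=> i; exists (fun x => x^-1); split; first by move=> x; exact: is_derive1_ln.
apply: Cn_inv; last exact: Cn1_id.
by move=> x /= x0; rewrite gt_eqF.
Qed.

(* The signs make the odd root smooth near a negative value as well. *)
Lemma Cn_root (R : realType) (X : normedModType R) (I : Type) (e : I -> X) n
  (U : set X) (h D : X -> R) (s : R) (k : nat) : odd k -> s \in [:: 1; -1] ->
  (forall x, U x -> 0 < s * h x) -> (forall x, U x -> D x ^+ k = h x) ->
  open U -> Cn e n U h -> Cn e n U D.
Proof.
move=> ok sE sh Dk oU Hh.
have k0 : (0 < k)%N by case: k ok {Dk}.
have ss : s * s = 1 by move: sE; rewrite !inE => /orP[] /eqP ->; rewrite ?mulr1 ?mulrNN ?mulr1.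
have sk : s ^+ k = s.
  by move: sE; rewrite !inE => /orP[] /eqP ->; rewrite ?expr1n// -signr_odd ok.
have sD x : U x -> 0 < s * D x.
  by move=> Ux; have := sh _ Ux; rewrite -(Dk _ Ux) -[X in X * _]sk -exprMn exprn_odd_gt0.
(* For odd k, s^k = s, so (s D)^k = s h > 0 and s D is the positive root, written with exp and ln,
   whose derivatives are known. *)
apply: (@Cn_eq _ _ _ e n U (fun x => s * expR (k%:R^-1 * ln (s * h x)))) => //.
  move=> x Ux; rewrite -(Dk _ Ux) -[X in X * _ ^+ _]sk -exprMn lnXn ?sD//.
  rewrite mulrnAr -mulrnAl -[_^-1 *+ k]mulr_natr mulVf ?pnatr_eq0 -?lt0n// mul1r lnK ?posrE ?sD//.
  by rewrite mulrA ss mul1r.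
apply: Cn_mul; first exact: Cn_cst.
apply: (@Cn_comp _ _ _ _ _ setT) => //; first exact: Cn1_expR.
apply: Cn_mul; first exact: Cn_cst.
apply: (@Cn_comp _ _ _ _ _ [set x : R | 0 < x]); [|exact: Cn1_ln|] => //.
by apply: Cn_mul; first exact: Cn_cst.
Qed.

(** * Comparison of [Cn] with [smooth_on], for scalar and matrix-valued maps *)

Section Bridge.
Variables (R : realType) (d : nat).
Implicit Type O : set 'rV[R]_d.
Notation CnE := (Cn (@ebasis R d)).

Lemma smooth_on_entry_Cn m m' O (F : 'rV[R]_d -> 'M[R]_(m, m')) i j n :
  smooth_on O F -> CnE n O (fun x => F x i j).
Proof.
move=> sF; suff H l : CnE n O (fun x => pder l F x i j) by exact: (H [::]).
have cF k : forall x, O x -> {for x, continuous (fun x => pder k F x i j)}.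
  move=> x Ox; apply: (@continuous_comp _ _ _ (pder k F) (fun M => M i j)).
    exact: (sF k).1.
  exact: coord_continuous.
elim: n l => [|n IH] l; split; try exact: cF; first by [].
move=> a; exists (fun x => pder (a :: l) F x i j); split => // x Ox.
have df := (sF l).2 a x Ox.
apply: DeriveDef; first exact: (proj1 (derivable_mxP _ _ _) df i j).
by rewrite /= derive_mx// mxE.
Qed.

Lemma Cn_pder O (f : 'rV[R]_d -> R) : open O -> (forall n, CnE n O f) ->
  forall l n, CnE n O (pder l f).
Proof.
move=> oO Cf; elim=> [//|a l IH] n /=.
have [_ /(_ a)[f' [f'd f'n]]] := IH n.+1.
by apply: Cn_eq f'n => // x /f'd[_ ->].
Qed.

Lemma Cn_smooth_on O (f : 'rV[R]_d -> R) : open O -> (forall n, CnE n O f) ->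
  smooth_on O f.
Proof.
move=> oO Cf l; split.
  exact: (Cn_continuous (Cn_pder oO Cf l 0)).
move=> i x Ox; have [_ /(_ i)[f' [f'd _]]] := Cn_pder oO Cf l 1.
by case: (f'd _ Ox).
Qed.

Lemma continuous_mx (T : topologicalType) m m' (F : T -> 'M[R]_(m, m')) x :
  (forall i j, {for x, continuous (fun y => F y i j)}) -> {for x, continuous F}.
Proof.
move=> cF; apply/cvgrPdist_le => /= eps e0.
have aux (ij : 'I_m * 'I_m') : \forall y \near x,
    `|F x ij.1 ij.2 - F y ij.1 ij.2| <= eps.
  by move: ij => [a b]; have /cvgrPdist_le := cF a b; exact.
suff : \forall y \near x, forall ij : 'I_m * 'I_m', `|F x ij.1 ij.2 - F y ij.1 ij.2| <= eps.
  apply: filterS => y Hy.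
  rewrite /Num.Def.normr/= mx_normrE (bigmax_le _ (ltW e0))//= => ij _.
  by rewrite !mxE/=.
exact: filter_forall.
Qed.

Lemma smooth_on_mx m m' O (F : 'rV[R]_d -> 'M[R]_(m, m')) : open O ->
  (forall i j, smooth_on O (fun x => F x i j)) -> smooth_on O F.
Proof.
move=> oO sF.
have H l x : O x -> pder l F x = \matrix_(i, j) pder l (fun x => F x i j) x.
  elim: l x => [|a l IH] x Ox /=; first by apply/matrixP => i j; rewrite mxE.
  (* The entrywise formula is known on O only; as O is open it holds near x, which is enough to
     differentiate it once more. *)
  have nE : \near x, pder l F x = \matrix_(i, j) pder l (fun x => F x i j) x.
    by near=> y; apply: IH; near: y; exact: open_nbhs_nbhs.
  rewrite (near_eq_derive _ nE) derive_mx; last first.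
    apply/derivable_mxP => i j; under eq_fun do rewrite mxE.
    exact: (sF i j l).2.
  apply/matrixP => i j; rewrite !mxE; congr ('D_ _ _ _).
  by apply/funext => y; rewrite mxE.
move=> l; split => [x Ox|i x Ox].
- apply: (@continuous_eq_open _ _ _ O
    (fun x => \matrix_(i, j) pder l (fun x => F x i j) x)) => //.
    by move=> y Oy; rewrite H.
  apply: continuous_mx => i j.
  rewrite (_ : (fun _ => _) = pder l (fun x => F x i j)); last by apply/funext => y; rewrite mxE.
  exact: (sF i j l).1.
- apply: (@near_eq_derivable _ _ _
    (fun x => \matrix_(i, j) pder l (fun x => F x i j) x)).
    by near=> y; apply/esym/H; near: y; exact: open_nbhs_nbhs.
  apply/derivable_mxP => a b; under eq_fun do rewrite mxE.
  exact: (sF a b l).2.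
Unshelve. all: by end_near. Qed.

Lemma is_derive_coord (x : 'rV[R]_d) (i j : 'I_d) :
  is_derive x (ebasis R i) (fun y : 'rV[R]_d => y 0 j) (i == j)%:R.
Proof.
have [dd E] : is_derive x (ebasis R i) (@id 'rV[R]_d) (ebasis R i).
  exact: is_derive_id.
apply: DeriveDef; first exact: (proj1 (derivable_mxP _ _ _) dd 0 j).
have := derive_mx dd; rewrite E => /matrixP/(_ 0 j).
by rewrite !mxE eqxx /= eq_sym => <-.
Qed.

Lemma Cn_coord n O (j : 'I_d) : CnE n O (fun y : 'rV[R]_d => y 0 j).
Proof.
have cc x : O x -> {for x, continuous (fun y : 'rV[R]_d => y 0 j)}.
  by move=> _; exact: coord_continuous.
case: n => [|n]; split => // i; exists (fun=> (i == j)%:R); split.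
  by move=> x _; exact: is_derive_coord.
exact: Cn_cst.
Qed.

End Bridge.

(** * Smooth cutoffs *)

Section FlatFunction.
Variable R : realType.
Implicit Types (p q : {poly R}) (x y : R).

(* The functions p(1/x) exp(-1/x) form a family stable under derivation. *)
Definition flat p x : R := if 0 < x then p.[x^-1] * expR (- x^-1) else 0.

Lemma flat_le0 p x : x <= 0 -> flat p x = 0.
Proof. by rewrite /flat ltNge => ->. Qed.

(** The term of degree i + 1 of the exponential series at 1/x gives x^-(i+1) <= (i+1)! exp(1/x),
    which bounds the monomial of degree i. One power of x is kept because the difference quotients
    at 0 must tend to 0. *)
Lemma flat_bound p : exists C : R, forall x, `|flat p x| <= C * `|x|.
Proof.
exists (\sum_(i < size p) `|p`_i| * (i.+1)`!%:R) => x.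
have C0 : 0 <= \sum_(i < size p) `|p`_i| * (i.+1)`!%:R.
  by apply: sumr_ge0 => i _; rewrite mulr_ge0.
rewrite /flat; case: ltP => x0; last by rewrite normr0 mulr_ge0.
rewrite (gtr0_norm x0) normrM (ger0_norm (expR_ge0 _)) horner_coef expRN.
rewrite ler_pdivrMr ?expR_gt0// mulr_suml mulr_suml.
apply: le_trans (ler_norm_sum _ _ _) _; apply: ler_sum => i _.
have xi0 : 0 <= x^-1 by rewrite invr_ge0 ltW.
rewrite normrM -!mulrA ler_wpM2l// ger0_norm ?exprn_ge0//.
have := expR_ge1Dxn i (ltW (_ : 0 < x^-1)); rewrite invr_gt0 => /(_ x0) H.
have f0 : 0 < (i.+1)`!%:R :> R by rewrite ltr0n fact_gt0.
have : x^-1 ^+ i.+1 / (i.+1)`!%:R <= expR x^-1 by apply: le_trans H; rewrite lerDr.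
rewrite ler_pdivrMr// => H2.
by rewrite mulrCA -ler_pdivrMl// -exprS [_ * expR _]mulrC.
Qed.

(** Differentiating p(1/x) exp(-1/x) produces -p'(1/x)/x^2 from the first factor and p(1/x)/x^2 from
    the second. *)
Definition dflat p : {poly R} := (p - p^`()) * 'X^2.

Lemma is_derive_flat p x : is_derive x 1 (flat p) (flat (dflat p) x).
Proof.
have [x0|x0|->] := ltgtP x 0.
- rewrite (flat_le0 _ (ltW x0)).
  apply: (@near_eq_is_derive _ _ _ (fun=> 0)).
  near=> y; rewrite flat_le0//; apply/ltW; near: y.
  exact: lt_nbhsl.
- apply: (@near_eq_is_derive _ _ _ (fun x => p.[x^-1] * expR (- x^-1))).
    near=> y; rewrite /flat ifT//; near: y; exact: lt_nbhsr.
  have xn0 : x != 0 by rewrite gt_eqF.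
  have dV : is_derive x 1 (fun y : R => y^-1) (- x ^- 2).
    apply: DeriveDef; first exact: derivableV.
    by rewrite deriveV// derive_id /GRing.scale/= mulr1.
  have dp : is_derive x^-1 1 (horner p) p^`().[x^-1].
    apply: DeriveDef; first exact: derivable_horner.
    by rewrite -derive1E -derivE.
  have d1 := is_derive_comp1 dV dp.
  have dN : is_derive x 1 (fun y : R => - y^-1) (x ^- 2).
    by rewrite -[x ^- 2]opprK; exact: is_deriveN.
  have d2 := is_derive_comp1 dN (is_derive_expR (- x^-1)).
  have d3 := is_deriveM d1 d2.
  apply: is_derive_eq d3 _.
  rewrite /flat x0 /dflat !hornerE /GRing.scale/= -exprVn.
  by ring.
(* At 0, dividing by h amounts to multiplying p by ['X], so the difference quotient is again a flat
   function and is bounded linearly. *)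
- have [C HC] := flat_bound (p * 'X).
  have C0 : 0 <= C by have := le_trans (normr_ge0 _) (HC 1); rewrite normr1 mulr1.
  rewrite flat_le0//.
  suff H : (fun h : R => h^-1 *: ((flat p \o shift 0) (h *: 1) - flat p 0)) @ 0^' --> (0 : R).
    apply: DeriveDef; first by apply/cvg_ex; exists 0.
    exact/cvg_lim.
  apply/cvgrPdist_le => /= eps e0; near=> h.
  rewrite (@flat_le0 p 0)// subr0 sub0r normrN /= addr0 [_%:A]mulr1.
  have -> : h^-1 *: flat p h = flat (p * 'X) h.
    rewrite /flat; case: ifP => h0; last by rewrite scaler0.
    by rewrite hornerM hornerX /GRing.scale/=; ring.
  apply: le_trans (HC _) _.
  have : `|h| <= eps / (C + 1).
    near: h; apply: dnbhs0_le; rewrite divr_gt0//.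
    by rewrite ltr_wpDl.
  rewrite ler_pdivlMr ?ltr_wpDl// => Hh; apply: le_trans Hh.
  by rewrite mulrC ler_wpM2l// lerDl.
Unshelve. all: by end_near. Qed.

Lemma Cn1_flat n p : Cn1 n setT (flat p).
Proof.
have cf q x : {for x, continuous (flat q)}.
  apply/differentiable_continuous/derivable1_diffP.
  by case: (is_derive_flat q x).
elim: n p => [|n IH] p; split => // _.
by exists (flat (dflat p)); split => // x _; exact: is_derive_flat.
Qed.

End FlatFunction.

Section SmoothRamp.
Variable R : realType.
Implicit Types (y : R).

Definition sstep y : R := flat 1 y / (flat 1 y + flat 1 (1 - y)).

Lemma flat1_ge0 y : 0 <= flat 1 y.
Proof. by rewrite /flat; case: ifP => // _; rewrite hornerC mul1r expR_ge0. Qed.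

Lemma flat1_gt0 y : 0 < y -> 0 < flat 1 y.
Proof. by move=> y0; rewrite /flat y0 hornerC mul1r expR_gt0. Qed.

Lemma sstep_den_gt0 y : 0 < flat 1 y + flat 1 (1 - y).
Proof.
have [y0|y0] := ltP 0 y; first by rewrite ltr_pwDl ?flat1_gt0 ?flat1_ge0.
by rewrite ltr_wpDl ?flat1_gt0 ?flat1_ge0//; lra.
Qed.

Lemma sstep_ge0 y : 0 <= sstep y.
Proof. by rewrite divr_ge0 ?flat1_ge0// ltW ?sstep_den_gt0. Qed.

Lemma sstep_le1 y : sstep y <= 1.
Proof. by rewrite ler_pdivrMr ?sstep_den_gt0// mul1r lerDl flat1_ge0. Qed.

Lemma sstep_le0 y : y <= 0 -> sstep y = 0.
Proof. by move=> y0; rewrite /sstep flat_le0// mul0r. Qed.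

Lemma sstep_ge1 y : 1 <= y -> sstep y = 1.
Proof.
move=> y1; rewrite /sstep [flat 1 (1 - y)]flat_le0 ?subr_le0// addr0 divff//.
by rewrite gt_eqF// flat1_gt0// (lt_le_trans _ y1).
Qed.

Lemma Cn1_sstep n : Cn1 n setT sstep.
Proof.
apply: Cn_mul; first exact: Cn1_flat.
apply: Cn_inv; first by move=> x _; rewrite gt_eqF ?sstep_den_gt0.
apply: Cn_add; first exact: Cn1_flat.
apply: (@Cn_comp _ _ _ _ _ setT) => //; first exact: Cn1_flat.
apply: (@Cn_eq _ _ _ _ _ _ (fun x : R => 1 + (-1) * x)).
- exact: openT.
- by move=> x _; rewrite mulN1r.
- by apply: Cn_add; [exact: Cn_cst|apply: Cn_mul; [exact: Cn_cst|exact: Cn1_id]].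
Qed.

(* lam^-1 * ramp (lam * y) tends to the positive part of y and its derivative to
   the indicator of y > 0: smooth primitives are obtained without integration. *)
Definition ramp y : R := y * sstep y.

Lemma Cn1_ramp n : Cn1 n setT ramp.
Proof. by apply: Cn_mul; [exact: Cn1_id|exact: Cn1_sstep]. Qed.

Lemma ramp_le0 y : y <= 0 -> ramp y = 0.
Proof. by move=> y0; rewrite /ramp sstep_le0// mulr0. Qed.

Lemma ramp_ge1 y : 1 <= y -> ramp y = y.
Proof. by move=> y0; rewrite /ramp sstep_ge1// mulr1. Qed.

Lemma ramp_norm y : `|ramp y| <= `|y|.
Proof.
by rewrite /ramp normrM (ger0_norm (sstep_ge0 _)) ler_piMr// sstep_le1.
Qed.

Definition dramp y : R := 'D_1 ramp y.

Lemma is_derive_ramp y : is_derive y 1 ramp (dramp y).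
Proof.
apply: derivableP; have [_ /(_ tt)[f' [f'd _]]] := Cn1_ramp 1.
by case: (f'd y I).
Qed.

Lemma continuous_dramp : continuous dramp.
Proof.
have [_ /(_ tt)[f' [f'd [cf' _]]]] := Cn1_ramp 1.
suff -> : dramp = f' by move=> x; exact: cf'.
by apply/funext => y; case: (f'd y I).
Qed.

Lemma dramp_lt0 y : y < 0 -> dramp y = 0.
Proof.
move=> y0; rewrite /dramp (@near_eq_derive _ _ _ _ (fun=> 0)) ?derive_cst//.
near=> z; apply: ramp_le0; apply: ltW; near: z; exact: lt_nbhsl.
Unshelve. all: by end_near. Qed.

Lemma dramp_gt1 y : 1 < y -> dramp y = 1.
Proof.
move=> y0; rewrite /dramp (@near_eq_derive _ _ _ _ id) ?derive_id//.
near=> z; apply: ramp_ge1; apply: ltW; near: z; exact: lt_nbhsr.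
Unshelve. all: by end_near. Qed.

(** The point 0 is included so that the derivative of a ramp vanishes for z <= c, in accordance with
    boxes that are open below. *)
Lemma dramp_0 : dramp 0 = 0.
Proof.
have [_ /(_ tt)[f' [f'd _]]] := Cn1_sstep 1.
have d := is_deriveM (is_derive_id (0 : R) (1 : R)) (f'd 0 I).
have [_ <-] := is_derive_ramp 0.
have [_ ->] := d; by rewrite sstep_le0// !scale0r addr0.
Qed.

Lemma dramp_le0 y : y <= 0 -> dramp y = 0.
Proof. by rewrite le_eqVlt => /predU1P[->|/dramp_lt0//]; exact: dramp_0. Qed.

Lemma dramp_bound : exists C : R, forall y, `|dramp y| <= C.
Proof.
have cf : {within `[0, 1 + 1], continuous (fun y => `|dramp y|)}.
  apply: continuous_subspaceT => y.
  apply: (@continuous_comp _ _ _ dramp Num.norm); first exact: continuous_dramp.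
  exact: norm_continuous.
have le02 : (0 : R) <= 1 + 1 by lra.
have [c _ Hc] := EVT_max le02 cf.
exists (Num.max 1 `|dramp c|) => y; rewrite le_max.
have [y0|y0] := leP y 0; first by rewrite dramp_le0// normr0 ler01.
have [y1|y1] := ltP 1 y; first by rewrite dramp_gt1// normr1 lexx.
by apply/orP; right; apply: Hc; rewrite in_itv/=; apply/andP; split; lra.
Qed.

End SmoothRamp.

(** * Recovering a matrix from its compound *)

Section CompoundAlgebra.
Variables (R : realType) (d k : nat).
Implicit Types (A : 'M[R]_d) (g h : 'I_k -> 'I_d).

Definition minor A g h : R := \det (\matrix_(a < k, b < k) A (g a) (h b)).

(** The coefficients do not depend on A: the value depends on the compound alone, so that it can be
    computed from the entries of [F x] when A is unknown. *)
Definition compound_linear (phi : 'M[R]_d -> R) : Prop :=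
  exists c : 'M[R]_(dimext d k),
    forall A, phi A = \sum_p \sum_q c p q * extpow k A p q.

Lemma compound_linear0 : compound_linear (fun=> 0).
Proof.
exists 0 => A; rewrite big1// => p _; rewrite big1// => q _.
by rewrite mxE mul0r.
Qed.

Lemma compound_linearD phi psi : compound_linear phi -> compound_linear psi ->
  compound_linear (fun A => phi A + psi A).
Proof.
move=> [c Hc] [c' Hc']; exists (c + c') => A; rewrite Hc Hc' -big_split /=.
apply: eq_bigr => p _; rewrite -big_split /=; apply: eq_bigr => q _.
by rewrite [(c + c') p q]mxE mulrDl.
Qed.

Lemma compound_linearZ a phi : compound_linear phi ->
  compound_linear (fun A => a * phi A).
Proof.
move=> [c Hc]; exists (a *: c) => A; rewrite Hc mulr_sumr.
apply: eq_bigr => p _; rewrite mulr_sumr; apply: eq_bigr => q _.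
by rewrite [(a *: c) p q]mxE mulrA.
Qed.

Lemma compound_linear_sum (J : Type) (r : seq J) (P : pred J)
    (F : J -> 'M[R]_d -> R) : (forall j, compound_linear (F j)) ->
  compound_linear (fun A => \sum_(j <- r | P j) F j A).
Proof.
move=> HF; elim: r => [|j r IH].
  by under eq_fun do rewrite big_nil; exact: compound_linear0.
under eq_fun do rewrite big_cons.
by case: (P j) => //; exact: compound_linearD.
Qed.

(** The compound lists only minors with increasing indices. An injective g is the enumeration of its
    image composed with a permutation, and the permutation costs a sign. *)
Lemma kelt_perm g : injective g ->
  exists (J : kset d k) (s : 'S_k), forall a, g a = kelt J (s a).
Proof.
move=> gI.
have cJ : #|[set g a | a : 'I_k]| == k by rewrite card_imset// card_ord.
pose J : kset d k := exist (fun I : {set 'I_d} => #|I| == k) _ cJ.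
have gJ a : g a \in val J by apply/imsetP; exists a.
pose r a : 'I_k := cast_ord (eqP (valP J)) (enum_rank_in (gJ a) (g a)).
have kr a : kelt J (r a) = g a.
  rewrite /kelt /r (_ : cast_ord _ _ = enum_rank_in (gJ a) (g a)); last exact: val_inj.
  by rewrite enum_rankK_in.
have rI : injective r by move=> a b /(congr1 (kelt J)); rewrite !kr => /gI.
by exists J, (perm rI) => a; rewrite permE kr.
Qed.

Lemma minor_tr A g h : minor A^T h g = minor A g h.
Proof.
by rewrite /minor -det_tr; congr (\det _); apply/matrixP => a b; rewrite !mxE.
Qed.

Lemma minor_not_inj A g h : ~ injective g -> minor A g h = 0.
Proof.
move=> /injectiveP; rewrite /injectiveb => /injectivePn[a [b ab gab]].
by rewrite /minor (determinant_alternate ab)// => c; rewrite !mxE gab.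
Qed.

Lemma minor_linear g h : compound_linear (fun A => minor A g h).
Proof.
have [gI|gI] := pselect (injective g); last first.
  by under eq_fun do rewrite minor_not_inj//; exact: compound_linear0.
have [hI|hI] := pselect (injective h); last first.
  under eq_fun do rewrite -minor_tr minor_not_inj//; exact: compound_linear0.
have [I1 [s gs]] := kelt_perm gI; have [I2 [t ht]] := kelt_perm hI.
exists ((-1) ^+ s * (-1) ^+ t *: delta_mx (enum_rank I1) (enum_rank I2)) => A.
rewrite (bigD1 (enum_rank I1))//= (bigD1 (enum_rank I2))//= !mxE !eqxx mulr1.
rewrite [X in _ + X + _]big1 ?addr0; last first.
  by move=> q /negbTE qN; rewrite !mxE qN andbF mulr0 mul0r.
rewrite [X in _ + X]big1 ?addr0; last first.
  by move=> p /negbTE pN; rewrite big1// => q _; rewrite !mxE pN mulr0 mul0r.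
rewrite !enum_rankK /minor.
set M := (X in _ = _ * \det X).
rewrite (_ : (\matrix_(a, b) _) = perm_mx s *m (M *m perm_mx t^-1)).
  by rewrite !det_mulmx !det_perm odd_permV -mulrA [_ * \det M]mulrC.
apply/matrixP => a b; rewrite -row_permE -col_permE !mxE gs ht.
by [].
Qed.

(** Cauchy-Binet before grouping by subsets: g runs over all maps, so neither an ordering nor
    injectivity is involved. Both are dealt with in [minor_linear]. *)
Lemma det_mulmx_rect n m (B : 'M[R]_(n, m)) (C : 'M[R]_(m, n)) :
  \det (B *m C) = \sum_(g : {ffun 'I_n -> 'I_m})
     (\prod_a B a (g a)) * \det (\matrix_(a < n, b < n) C (g a) b).
Proof.
rewrite /determinant.
transitivity (\sum_(s : 'S_n) \sum_(g : {ffun 'I_n -> 'I_m})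
   (-1) ^+ s * \prod_i (B i (g i) * C (g i) (s i))).
  apply: eq_bigr => s _; rewrite -mulr_sumr; congr (_ * _).
  rewrite -(bigA_distr_bigA (fun i j => B i j * C j (s i))).
  by apply: eq_bigr => i _; rewrite mxE.
rewrite exchange_big /=; apply: eq_bigr => g _; rewrite mulr_sumr.
apply: eq_bigr => s _; rewrite big_split /= mulrCA; congr (_ * (_ * _)).
by apply: eq_bigr => i _; rewrite mxE.
Qed.

Lemma det_sandwich_linear (U : 'M[R]_(k, d)) (V : 'M[R]_(d, k)) :
  compound_linear (fun A => \det (U *m A *m V)).
Proof.
rewrite (_ : (fun A => _) = fun A => \sum_(g : {ffun 'I_k -> 'I_d}) (\prod_a U a (g a)) *
    \sum_(h : {ffun 'I_k -> 'I_d}) (\prod_b V^T b (h b)) * minor A g h); last first.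
  apply/funext => A; rewrite -mulmxA det_mulmx_rect; apply: eq_bigr => g _.
  congr (_ * _).
  transitivity (\det (V^T *m (\matrix_(j < d, a < k) A (g a) j))).
    rewrite -det_tr; congr (\det _); apply/matrixP => a b; rewrite !mxE.
    by apply: eq_bigr => j _; rewrite !mxE mulrC.
  rewrite det_mulmx_rect; apply: eq_bigr => h _; congr (_ * _).
  by rewrite /minor -det_tr; congr (\det _); apply/matrixP => a b; rewrite !mxE.
apply: compound_linear_sum => g; apply: compound_linearZ.
apply: compound_linear_sum => h; apply: compound_linearZ.
exact: minor_linear.
Qed.

(** A = L Q factors through R^k, so each k-minor of A is a product of two determinants: the compound
    is a column times a row. *)
Lemma compound_rank_le1 A : (\rank A <= k)%N -> (\rank (extpow k A) <= 1)%N.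
Proof.
move=> rA.
have [L [Q ->]] : exists (L : 'M[R]_(d, k)) (Q : 'M[R]_(k, d)), A = L *m Q.
  exists (col_ebase A *m pid_mx (\rank A)), (pid_mx (\rank A) *m row_ebase A).
  rewrite -mulmxA [X in _ *m X]mulmxA mul_pid_mx minnn (minn_idPr rA).
  by rewrite mulmxA mulmx_ebase.
pose u : 'cV[R]_(dimext d k) :=
  \col_p \det (\matrix_(a < k, b < k) L (kelt (enum_val p) a) b).
pose v : 'rV[R]_(dimext d k) :=
  \row_q \det (\matrix_(a < k, b < k) Q a (kelt (enum_val q) b)).
rewrite (_ : extpow k _ = u *m v).
  by apply: leq_trans (mxrankM_maxr _ _) _; exact: rank_leq_row.
apply/matrixP => p q; rewrite !mxE big_ord1 !mxE -det_mulmx.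
by congr (\det _); apply/matrixP => a b; rewrite !mxE; apply: eq_bigr => j _; rewrite !mxE.
Qed.

End CompoundAlgebra.

Section AdjugateRecovery.
Variable R : realType.

Lemma det_adj n (M : 'M[R]_n.+1) : \det M != 0 -> \det (\adj M) = \det M ^+ n.
Proof.
move=> M0; apply: (mulfI M0).
by rewrite -det_mulmx mul_mx_adj det_scalar exprS.
Qed.

(** If det M = 0, then M adj M = 0, and cancelling an invertible adj M gives M = 0. The adjugate of
    0 vanishes because its cofactors have positive size; for n = 0 it would be 1. *)
Lemma det_adj_neq0 n (M : 'M[R]_n.+1) : (0 < n)%N ->
  \det (\adj M) != 0 -> \det M != 0.
Proof.
move=> n0; apply: contraNneq => M0.
have [//|aM] := eqVneq (\det (\adj M)) 0.
have MZ : M = 0.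
  have := mul_mx_adj M; rewrite M0 raddf0 => /(congr1 (mulmx^~ (invmx (\adj M)))).
  by rewrite mulmxK ?mul0mx// unitmxE unitfE.
suff aZ : \adj M = 0 by move: aM; rewrite aZ det0 eqxx.
  apply/matrixP => i j; rewrite !mxE /cofactor MZ.
rewrite (_ : row' _ _ = 0); last by apply/matrixP => a b; rewrite !mxE.
have dz m : (0 < m)%N -> \det (0 : 'M[R]_m) = 0 by case: m => // m _; rewrite det0.
by rewrite dz ?mulr0.
Qed.

(* Together with det_adj: when n is odd, M is a smooth function of adj M near an
   invertible M. *)
Lemma mx_from_adj n (M : 'M[R]_n.+1) i j : \det (\adj M) != 0 ->
  M i j = \det M * ((\det (\adj M))^-1 * (\adj (\adj M)) i j).
Proof.
move=> a0; have u : \adj M \in unitmx by rewrite unitmxE unitfE.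
have := mul_mx_adj M => /(congr1 (mulmx^~ (invmx (\adj M)))).
rewrite mulmxK// mul_scalar_mx => /matrixP/(_ i j) ->.
by rewrite mxE /invmx u mxE.
Qed.

(** Deleting a row and a column of U A V amounts to deleting a row of U and a column of V, so each
    cofactor is again a determinant of a compression, of size k. *)
Lemma adj_sandwich_linear d k (U : 'M[R]_(k.+1, d)) (V : 'M[R]_(d, k.+1)) i j :
  compound_linear k (fun A => (\adj (U *m A *m V)) i j).
Proof.
under eq_fun => A.
  rewrite mxE /cofactor (_ : row' _ _ = row' j U *m A *m col' i V); first over.
  apply/matrixP => a b; rewrite !mxE; apply: eq_bigr => c _; rewrite !mxE.
  by congr (_ * _); apply: eq_bigr => e _; rewrite !mxE.
apply: compound_linearZ; exact: det_sandwich_linear.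
Qed.

Lemma sandwich_unit d k (A : 'M[R]_d) : (k < \rank A)%N ->
  exists (U : 'M[R]_(k.+1, d)) (V : 'M[R]_(d, k.+1)), U *m A *m V = 1%:M.
Proof.
move=> rA; exists (pid_mx k.+1 *m invmx (col_ebase A)), (invmx (row_ebase A) *m pid_mx k.+1).
rewrite -{2}(mulmx_ebase A) -!mulmxA mulKVmx ?row_ebase_unit//.
rewrite (mulKmx (col_ebase_unit A)).
have rd : (k < d)%N := leq_trans rA (rank_leq_col A).
by rewrite !mul_pid_mx (minn_idPr rA) (minn_idPr rd) minnn (minn_idPr rd) pid_mx_1.
Qed.

Lemma odd_expr_inj k (s a b : R) : odd k -> 0 < s * a ^+ k -> s \in [:: 1; -1] ->
  a ^+ k = b ^+ k -> a = b.
Proof.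
move=> ok; have k0 : (0 < k)%N by case: k ok.
have H (x y : R) : 0 < x ^+ k -> x ^+ k = y ^+ k -> x = y.
  move=> x0 xy; apply: (pexpIrn k0) => //; rewrite nnegrE ltW// -(exprn_odd_gt0 _ ok)//.
  by rewrite -xy.
move=> + sE ab; move: sE; rewrite !inE => /orP[] /eqP ->; first by rewrite mul1r => /H; exact.
rewrite mulN1r => a0; apply: oppr_inj; apply: H; rewrite exprNn -signr_odd ok mulN1r//.
by rewrite exprNn -signr_odd ok mulN1r ab.
Qed.

End AdjugateRecovery.

Lemma Cn_mulmx (R : realType) (X : normedModType R) (I : Type) (e : I -> X) n (U : set X) m1 m2 m3 (M : X -> 'M[R]_(m1, m2)) (N : X -> 'M[R]_(m2, m3)) :
  (forall i j, Cn e n U (fun x => M x i j)) -> (forall i j, Cn e n U (fun x => N x i j)) ->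
  forall i j, Cn e n U (fun x => (M x *m N x) i j).
Proof.
move=> HM HN i j; under eq_fun do rewrite mxE.
by apply: Cn_sum => l; exact: Cn_mul.
Qed.

(** * Smooth local inversion of the compound *)

Section LocalRecovery.
Variables (R : realType) (X : normedModType R) (I : Type) (e : I -> X).
Variables (d k : nat) (O : set X) (F : X -> 'M[R]_(dimext d k)).
Hypotheses (oO : open O) (ok : odd k).
Hypothesis CF : forall n p q, Cn e n O (fun x => F x p q).

Lemma open_pos (h : X -> R) : (forall x, O x -> {for x, continuous h}) ->
  open [set x | O x /\ 0 < h x].
Proof.
move=> ch; rewrite openE => x [Ox hx]; apply: filterI; first exact: open_nbhs_nbhs.
exact: (ch x Ox _ (lt_nbhsr hx)).
Qed.


(** The functions phi are built from [F] alone and serve every A above x at once, whence local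
    uniqueness as well as smoothness. *)
Lemma sandwich_recovery x0 A0 (U : 'M[R]_(k.+1, d)) (V : 'M[R]_(d, k.+1)) :
  O x0 -> extpow k A0 = F x0 -> \det (U *m A0 *m V) != 0 ->
  exists (W : set X) (phi : 'I_k.+1 -> 'I_k.+1 -> X -> R),
    [/\ open W, W x0, W `<=` O, forall n i j, Cn e n W (phi i j) &
      forall x A i j, W x -> extpow k A = F x -> (U *m A *m V) i j = phi i j x].
Proof.
move=> Ox0 FA0 dA0.
have k0 : (0 < k)%N by case: k ok.
have [c Hc] : exists c : 'I_k.+1 -> 'I_k.+1 -> 'M[R]_(dimext d k), forall i j A,
    (\adj (U *m A *m V)) i j = \sum_p \sum_q c i j p q * extpow k A p q.
  have /choice[c Hc] := fun ij : 'I_k.+1 * 'I_k.+1 => adj_sandwich_linear U V ij.1 ij.2.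
  by exists (fun i j => c (i, j)) => i j A; exact: (Hc (i, j)).
pose N x : 'M[R]_k.+1 := \matrix_(i, j) \sum_p \sum_q c i j p q * F x p q.
have CN n i j : Cn e n O (fun x => N x i j).
  under eq_fun do rewrite mxE.
  by apply: Cn_sum => p; apply: Cn_sum => q; apply: Cn_mul => //; exact: Cn_cst.
have NE x A : extpow k A = F x -> N x = \adj (U *m A *m V).
  by move=> EA; apply/matrixP => i j; rewrite mxE Hc EA.
pose h x := \det (N x).
have Ch n : Cn e n O h by apply: Cn_det.
have h0 : h x0 != 0 by rewrite /h (NE _ _ FA0) det_adj// expf_neq0.
pose s : R := Num.sg (h x0).
have sE : s \in [:: 1; -1] by rewrite /s; case: sgrP h0; rewrite ?inE ?eqxx// orbT.
have ss : s * s = 1 by rewrite /s -expr2 sqr_sg h0.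
have sk : s ^+ k = s.
  by move: sE; rewrite !inE => /orP[] /eqP ->; rewrite ?expr1n// -signr_odd ok.
(* Here h = det (adj (U A V)) = (det (U A V))^k keeps the sign s that it has at x0, so that its odd
   root [D] is smooth. *)
pose W := [set x | O x /\ 0 < s * h x].
have oW : open W.
  by apply: open_pos => x Ox; apply: (Cn_continuous (Cn_mul (Cn_cst _ 0 _ _) (Ch 0%N))).
have WO : W `<=` O by move=> x [].
have Wx0 : W x0 by split => //; rewrite /s -normrEsg normr_gt0.
have hW x : W x -> h x != 0.
  by move=> [_]; apply: contraTneq => ->; rewrite mulr0 ltxx.
pose D x := s * expR (k%:R^-1 * ln (s * h x)).
have Dk x : W x -> D x ^+ k = h x.
  move=> [_ sh]; rewrite /D exprMn sk -expRM_natr mulrAC mulVf ?mul1r; last first.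
    by rewrite pnatr_eq0 -lt0n.
  by rewrite lnK// mulrA ss mul1r.
have CD n : Cn e n W D.
  apply: (@Cn_root _ _ _ _ _ W h D s k) => //; first by move=> x [].
  exact: Cn_sub WO (Ch n).
exists W, (fun i j x => D x * ((h x)^-1 * (\adj (N x)) i j)); split => //.
  move=> n i j; apply: Cn_mul => //; apply: Cn_mul.
    by apply: Cn_inv => //; exact: Cn_sub WO (Ch n).
  by apply: Cn_adj => a b; exact: Cn_sub WO (CN _ _ _).
move=> x A i j Wx EA; have hx := hW _ Wx; move: (hx); rewrite /h (NE _ _ EA) => ax.
rewrite mx_from_adj// -(NE _ _ EA); congr (_ * _).
have dM : \det (U *m A *m V) ^+ k = h x.
  by rewrite /h (NE _ _ EA) det_adj//; exact: det_adj_neq0.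
apply: (@odd_expr_inj _ k s) => //; last by rewrite dM Dk.
by rewrite dM; case: Wx.
Qed.

(* Polarization: A i j is read off four compressions U A V of A to size k + 1,
   with U and V perturbed so that all four stay invertible. *)
Lemma entry_recovery x0 A0 i j :
  O x0 -> extpow k A0 = F x0 -> (k < \rank A0)%N ->
  exists (W : set X) (phi : X -> R),
    [/\ open W, W x0, W `<=` O, forall n, Cn e n W phi &
      forall x A, W x -> extpow k A = F x -> A i j = phi x].
Proof.
move=> Ox0 FA0 rA.
have [U [V UV]] := sandwich_unit rA.
pose E : 'M[R]_(k.+1, d) := delta_mx 0 i.
pose E' : 'M[R]_(d, k.+1) := delta_mx j 0.
pose M (t s : R) := (U + t *: E) *m A0 *m (V + s *: E').
have CM (a b : R) n r q : Cn1 n setT (fun t : R => M (a * t) (b * t) r q).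
  apply: Cn_mulmx; last first.
    move=> r' q'.
    rewrite (_ : (fun x => _) = fun x : R => V r' q' + (b * x) * E' r' q'); last first.
      by apply/funext => x; rewrite mxE [(_ *: E') _ _]mxE.
    apply: Cn_add; first exact: Cn_cst.
    by apply: Cn_mul; [apply: Cn_mul; [exact: Cn_cst|exact: Cn1_id]|exact: Cn_cst].
  apply: Cn_mulmx; last by move=> r' q'; exact: Cn_cst.
  move=> r' q'.
  rewrite (_ : (fun x => _) = fun x : R => U r' q' + (a * x) * E r' q'); last first.
    by apply/funext => x; rewrite mxE [(_ *: E) _ _]mxE.
  apply: Cn_add; first exact: Cn_cst.
  by apply: Cn_mul; [apply: Cn_mul; [exact: Cn_cst|exact: Cn1_id]|exact: Cn_cst].
(* At t = 0 the compression is the identity, of determinant 1; continuity then gives one t != 0 that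
   suits all the perturbed compressions. *)
have nM (a b : R) : \forall t \near 0^', \det (M (a * t) (b * t)) != 0.
  have cd : {for (0 : R), continuous (fun t : R => \det (M (a * t) (b * t)))}.
    exact: (Cn_continuous (Cn_det (CM a b 0%N)) (x := (0 : R)) Logic.I).
  have P : nbhs (\det (M (a * 0) (b * 0))) [set y : R | 0 < y].
    by apply: lt_nbhsr; rewrite !mulr0 /M !scale0r !addr0 UV det1.
  have Q := cd _ P; apply: nbhs_dnbhs; near=> t.
  suff : 0 < \det (M (a * t) (b * t)) by move=> /gt_eqF ->.
  by near: t; exact: Q.
have [t [t0 [d1 d2 d3]]] : exists t : R, t != 0 /\
    [/\ \det (M t t) != 0, \det (M t 0) != 0 & \det (M 0 t) != 0].
  have N1 : \forall t \near (0 : R)^', t != 0 by exact: nbhs_dnbhs_neq.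
  have [t []] := filter_ex (filterI N1 (filterI (nM 1 1) (filterI (nM 1 0) (nM 0 1)))).
  move=> t0 [+ [+ +]].
  by rewrite !mul1r !mul0r => *; exists t.
have d0 : \det (M 0 0) != 0 by rewrite /M !scale0r !addr0 UV det1 oner_eq0.
have [W1 [f1 [oW1 Wx1 WO1 C1 E1]]] := sandwich_recovery Ox0 FA0 d1.
have [W2 [f2 [oW2 Wx2 WO2 C2 E2]]] := sandwich_recovery Ox0 FA0 d2.
have [W3 [f3 [oW3 Wx3 WO3 C3 E3]]] := sandwich_recovery Ox0 FA0 d3.
have [W4 [f4 [oW4 Wx4 WO4 C4 E4]]] := sandwich_recovery Ox0 FA0 d0.
pose W := W1 `&` W2 `&` (W3 `&` W4).
(* The mixed difference M(t,t) + M(0,0) - M(t,0) - M(0,t) of a function affine in each variable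
   equals t^2 E A E', whose entry (0,0) is t^2 A i j. *)
exists W, (fun x => (t * t)^-1 * (f1 0 0 x + f4 0 0 x + (-1) * (f2 0 0 x + f3 0 0 x))).
split.
- by apply: openI; apply: openI.
- by [].
- by move=> x [[/WO1]].
- move=> n; apply: Cn_mul; first exact: Cn_cst.
  apply: Cn_add; [apply: Cn_add|apply: Cn_mul; [exact: Cn_cst|apply: Cn_add]].
  + by apply: Cn_sub (C1 n 0 0) => x [[]].
  + by apply: Cn_sub (C4 n 0 0) => x [_ []].
  + by apply: Cn_sub (C2 n 0 0) => x [[]].
  + by apply: Cn_sub (C3 n 0 0) => x [_ []].
move=> x A [[x1 x2] [x3 x4]] EA.
rewrite -(E1 _ _ 0 0 x1 EA) -(E2 _ _ 0 0 x2 EA) -(E3 _ _ 0 0 x3 EA) -(E4 _ _ 0 0 x4 EA).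
have AE : (E *m A *m E') 0 0 = A i j.
  rewrite mxE (bigD1 j)//= big1 ?addr0; last first.
    by move=> l /negbTE lj; rewrite [E' _ _]mxE lj mulr0.
  rewrite [E' _ _]mxE !eqxx mulr1 mxE (bigD1 i)//= big1 ?addr0; last first.
    by move=> l /negbTE lj; rewrite [E _ _]mxE lj andbF mul0r.
  by rewrite [E _ _]mxE !eqxx mul1r.
rewrite !scale0r !addr0 !(mulmxDl, mulmxDr) -!(scalemxAl, scalemxAr).
apply: (mulfI (mulf_neq0 t0 t0)); rewrite mulVKf ?mulf_neq0//.
rewrite -AE.
move: (U *m A *m V) (U *m A *m E') (E *m A *m V) (E *m A *m E') => m1 m2 m3 m4.
rewrite !mxE; ring.
Unshelve. all: by end_near. Qed.

End LocalRecovery.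

Section CompoundRoot.
Variables (R : realType) (d k : nat).

Lemma compound_image_closed (M : R) :
  closed [set B : 'M[R]_(dimext d k) | exists A : 'M[R]_d,
            (forall i j, `|A i j| <= M) /\ extpow k A = B].
Proof.
(* Flattened into rows, the matrices bounded by M form a product of segments, which is compact. *)
pose f (v : 'rV[R]_(d * d)) : 'M[R]_(dimext d k) := extpow k (vec_mx v).
pose K := [set v : 'rV[R]_(d * d) | forall j, `[- M, M]%classic (v 0 j)].
have cK : compact K := rV_compact (fun i => @segment_compact R (- M) M).
have cf : continuous f.
  move=> v; apply: continuous_mx => p q.
  have C : Cn (@ebasis R (d * d)) 0 setT (fun v => f v p q).
    rewrite (_ : (fun v => _) = fun v : 'rV[R]_(d * d) => \det (\matrix_(a < k, b < k)
      v 0 (mxvec_index (kelt (enum_val p) a) (kelt (enum_val q) b)))); last first.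
      apply/funext => w; rewrite /f mxE; congr (\det _).
      by apply/matrixP => a b; rewrite !mxE.
    apply: Cn_det => a b.
    rewrite (_ : (fun v => _) = fun v : 'rV[R]_(d * d) =>
      v 0 (mxvec_index (kelt (enum_val p) a) (kelt (enum_val q) b))); last first.
      by apply/funext => w; rewrite mxE.
    exact: Cn_coord.
  exact: (Cn_continuous C).
rewrite (_ : [set _ | _] = f @` K); last first.
  apply/seteqP; split => [B [A [AM <-]]|_ [v Kv <-]].
    exists (mxvec A); last by rewrite /f mxvecK.
    by case/mxvec_indexP => i j; rewrite /= mxvecE in_itv/= -ler_norml.
  exists (vec_mx v); split => // i j; rewrite mxE ler_norml.
  by have := Kv (mxvec_index i j); rewrite /= in_itv.
apply: compact_closed; first exact: norm_hausdorff.
apply: continuous_compact => //; exact: continuous_subspaceT.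
Qed.

Variables (X : normedModType R) (I : Type) (e : I -> X).
Variables (O : set X) (F : X -> 'M[R]_(dimext d k)).
Hypotheses (oO : open O) (ok : odd k) (k1 : (1 < k)%N).
Hypothesis CF : forall n p q, Cn e n O (fun x => F x p q).
Hypothesis HF : forall x, O x -> Htilde_gt (F x).

Lemma compound_root_exists (M : R) :
  (forall x W, O x -> open W -> W x -> exists y, W y /\
     exists A : 'M[R]_d, (forall i j, `|A i j| <= M) /\ extpow k A = F y) ->
  forall x, O x -> exists A, extpow k A = F x /\ (k < \rank A)%N.
Proof.
move=> dns x Ox.
have [A [_ EA]] : [set B | exists A : 'M[R]_d,
    (forall i j, `|A i j| <= M) /\ extpow k A = B] (F x).
  apply: compound_image_closed => B nB.
  have cF : {for x, continuous F}.
    by apply: continuous_mx => i j; exact: (Cn_continuous (CF 0 i j)).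
  have := cF _ nB; rewrite nbhsE => -[W [oW Wx] WB].
  have [y [Wy [A [AM EA]]]] := dns x W Ox oW Wx.
  by exists (F y); split; [exists A|exact: WB].
(* If rank A were at most k, the rank of [F x] would be both greater than k and at most 1, against 1
   < k. *)
exists A; split => //; rewrite ltnNge; apply/negP => rA.
have := HF Ox; rewrite /Htilde_gt -EA => /leq_trans/(_ (compound_rank_le1 rA)).
by rewrite ltnS leqn0; move: k1; case: (k).
Qed.

(** The matrices are picked by choice, without any regularity. Near each point the same smooth phi
    gives the entries of every solution, so the choice was forced. *)
Lemma compound_root_smooth :
  (forall x, O x -> exists A, extpow k A = F x /\ (k < \rank A)%N) ->
  exists A : X -> 'M[R]_d, (forall n i j, Cn e n O (fun x => A x i j)) /\
    forall x A', O x -> extpow k A' = F x -> A' = A x.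
Proof.
move=> HA.
have /choice[A AE] : forall x, exists A, O x -> extpow k A = F x /\ (k < \rank A)%N.
  move=> x; have [Ox|nOx] := pselect (O x); last by exists 0.
  by have [A HA'] := HA x Ox; exists A.
exists A; split.
  move=> n i j; apply: Cn_local => x Ox.
  have [EA rA] := AE x Ox.
  have [W [phi [oW Wx WO Cphi Ephi]]] := entry_recovery oO ok CF i j Ox EA rA.
  exists W => //; apply: (Cn_eq oW _ (Cphi n)) => y Wy.
  by rewrite (Ephi y (A y))//; have [] := AE y (WO _ Wy).
move=> x A' Ox EA'; apply/matrixP => i j.
have [EA rA] := AE x Ox.
have [W [phi [oW Wx WO Cphi Ephi]]] := entry_recovery oO ok CF i j Ox EA rA.
by rewrite (Ephi x A')// (Ephi x (A x)).
Qed.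

End CompoundRoot.

(** * Boxes *)

Section RowNorm.
Variables (R : realType) (d : nat).
Implicit Types (x y : 'rV[R]_d).

Lemma coord_le_norm x i : `|x 0 i| <= `|x|.
Proof.
rewrite [leRHS]/Num.Def.normr/= mx_normrE.
exact: (le_bigmax _ (fun ij : 'I_1 * 'I_d => `|x ij.1 ij.2|) (0, i)).
Qed.

Lemma norm_lt_coord x r : 0 < r -> (forall i, `|x 0 i| < r) -> `|x| < r.
Proof.
move=> r0 H; rewrite [ltLHS]/Num.Def.normr/= mx_normrE.
by apply: bigmax_lt => // -[i j] _ /=; rewrite ord1.
Qed.

Lemma open_cube (O : set 'rV[R]_d) x : open O -> O x ->
  exists2 r : R, 0 < r & forall y, (forall i, `|y 0 i - x 0 i| < r) -> O y.
Proof.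
move=> oO Ox; have : nbhs x O by exact: open_nbhs_nbhs.
move=> /nbhs_ballP[r /= r0 rO]; exists r => // y H; apply: rO.
rewrite -ball_normE /ball_/= distrC; apply: norm_lt_coord => // i.
by rewrite !mxE.
Qed.

Definition updrow x (i : 'I_d) (s : R) : 'rV[R]_d := \row_j (if j == i then s else x 0 j).

Lemma updrowE x i s : updrow x i s 0 i = s.
Proof. by rewrite mxE eqxx. Qed.

Lemma updrow_neq x i s j : j != i -> updrow x i s 0 j = x 0 j.
Proof. by rewrite mxE => /negbTE ->. Qed.

End RowNorm.

Section Boxes.
Variables (R : realType) (d : nat).
Implicit Types (a b : 'rV[R]_d).
Notation T := (Rd R d).

Definition box a b : set T :=
  [set x : T | forall i, a 0 i < (x : 'rV[R]_d) 0 i <= b 0 i].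

Definition vol a b : R := \prod_(i < d) (b 0 i - a 0 i).

Lemma open_measurable_Rd (U : set 'rV[R]_d) : open U -> measurable (U : set T).
Proof. by move=> oU; exact: sub_sigma_algebra. Qed.

Lemma measurable_continuous_Rd (O : set 'rV[R]_d) (f : 'rV[R]_d -> R) : open O ->
  (forall x, O x -> {for x, continuous f}) -> measurable_fun (O : set T) (f : T -> R).
Proof.
move=> oO cf; apply: (measurability _ (RGenOpens.measurableE R)).
move=> _ [_ [a [b ->] <-]]; apply: open_measurable_Rd.
rewrite openE => x [Ox fx]; apply: filterI; first exact: open_nbhs_nbhs.
apply: (cf x Ox); apply: open_nbhs_nbhs; split => //; exact: interval_open.
Qed.

Lemma measurable_coord i : measurable_fun setT (fun x : T => (x : 'rV[R]_d) 0 i).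
Proof.
apply: (@measurable_continuous_Rd setT); first exact: openT.
by move=> x _; exact: coord_continuous.
Qed.

Lemma measurable_box a b : measurable (box a b).
Proof.
rewrite (_ : box a b = \bigcap_(i in [set: 'I_d])
    ((fun x : T => (x : 'rV[R]_d) 0 i) @^-1` `]a 0 i, b 0 i]%classic)); last first.
  apply/seteqP; split => [x bx i _|x bx i]; first by rewrite /= in_itv; exact: bx.
  by have := bx i I; rewrite /= in_itv.
apply: fin_bigcap_measurable; first exact: finite_finset.
move=> i _; rewrite -[X in measurable X]setTI; apply: measurable_coord => //.
Qed.

Lemma box_empty a b i : b 0 i <= a 0 i -> box a b = set0.
Proof.
move=> ba; apply/seteqP; split => // x /(_ i)/andP[ax xb].
by have := lt_le_trans ax (le_trans xb ba); rewrite ltxx.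
Qed.

Lemma boxI a b a' b' : box a b `&` box a' b' =
  box (\row_i Num.max (a 0 i) (a' 0 i)) (\row_i Num.min (b 0 i) (b' 0 i)).
Proof.
apply/seteqP; split => [x [H H'] i|x H].
  by have := H i; have := H' i; rewrite !mxE gt_max le_min => /andP[-> ->] /andP[-> ->].
split=> i; have := H i; rewrite !mxE gt_max le_min => /andP[/andP[h1 h2] /andP[h3 h4]];
  by apply/andP.
Qed.

Lemma box_sub a b a' b' : (forall i, a 0 i <= a' 0 i) -> (forall i, b' 0 i <= b 0 i) ->
  box a' b' `<=` box a b.
Proof.
move=> aa bb x H i; have /andP[h1 h2] := H i; apply/andP; split.
  exact: le_lt_trans (aa i) h1.
exact: le_trans h2 (bb i).
Qed.

Lemma vol_gt0 a b : (forall i, a 0 i < b 0 i) -> 0 < vol a b.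
Proof. by move=> ab; apply: prodr_gt0 => i _; rewrite subr_gt0. Qed.

Lemma vol_updrow a b i s t :
  vol (updrow a i s) (updrow b i t) = (t - s) * \prod_(j < d | j != i) (b 0 j - a 0 j).
Proof.
rewrite /vol (bigD1 i)//= !updrowE; congr (_ * _).
by apply: eq_bigr => j ji; rewrite !updrow_neq.
Qed.

Lemma volD1 a b i : vol a b = (b 0 i - a 0 i) * \prod_(j < d | j != i) (b 0 j - a 0 j).
Proof. by rewrite /vol (bigD1 i). Qed.

Variable mu : {measure set T -> \bar R}.
Hypothesis leb : is_lebesgue mu.

Lemma mu_box a b : (forall i, a 0 i <= b 0 i) -> mu (box a b) = (vol a b)%:E.
Proof. exact: leb. Qed.

Lemma mu_box_lty a b : (mu (box a b) < +oo)%E.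
Proof.
have [H|/existsNP[i /negP]] := pselect (forall i, a 0 i <= b 0 i).
  by rewrite mu_box// ltry.
by rewrite -ltNge => /ltW/box_empty ->; rewrite measure0.
Qed.

(** A small box with upper corner x lies in U and has positive volume, so it is not contained in a
    null set. *)
Lemma ae_dense (P : T -> Prop) (U : set 'rV[R]_d) x : {ae mu, forall y, P y} ->
  open U -> U x -> exists y, U y /\ P y.
Proof.
move=> [N [mN N0 PN]] oU Ux; apply: contrapT => H.
have [r r0 rU] := open_cube oU Ux.
pose a : 'rV[R]_d := \row_i (x 0 i - r / 2).
have ax i : a 0 i < x 0 i by rewrite mxE; lra.
have : (mu (box a x) <= mu N)%E.
  apply: le_measure; rewrite ?inE//; first exact: measurable_box.
  move=> y by_; apply: PN => Py; apply: H; exists y; split => //.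
  apply: rU => i; have := by_ i; rewrite mxE => /andP[h1 h2].
  by rewrite ltr_norml; apply/andP; split; lra.
rewrite N0 mu_box; last by move=> i; exact: ltW.
by rewrite lee_fin leNgt vol_gt0.
Qed.

Lemma integrable_box (f : T -> R) a b (M : R) : measurable_fun (box a b) f ->
  (forall x, box a b x -> `|f x| <= M) -> mu.-integrable (box a b) (EFin \o f).
Proof.
move=> mf fM; apply: measurable_bounded_integrable => //.
- exact: measurable_box.
- exact: mu_box_lty.
- exists M; split; first exact: num_real.
  by move=> y My x bx; apply: le_trans (fM x bx) (ltW My).
Qed.

Lemma Rintegral_box_le (f : T -> R) a b (M : R) : (forall i, a 0 i <= b 0 i) ->
  measurable_fun (box a b) f ->
  (forall x, box a b x -> `|f x| <= M) ->
  `|\int[mu]_(x in box a b) f x| <= M * vol a b.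
Proof.
move=> ab mf fM; have fi := integrable_box mf fM.
apply: le_trans (le_normr_Rintegral _ fi) _; first exact: measurable_box.
have -> : M * vol a b = \int[mu]_(x in box a b) M.
  by rewrite Rintegral_cst ?mu_box//; exact: measurable_box.
apply: le_Rintegral => //; first exact: measurable_box.
- exact: integrable_norm.
- apply: (@integrable_box _ _ _ `|M|) => //.
Qed.

End Boxes.

(** * Smooth approximations of interval indicators and trapezoids *)

Section Cutoff.
Variable R : realType.
Implicit Types (lam c l h z s w L : R).

(** Both transitions start at their node and extend over a length 1/lam to its right. The limit for
    large lam is thus the indicator of the half-open []l, h]], and the support exceeds h a
    little. *)
Definition cutoff lam l h z : R := sstep (lam * (z - l)) * (1 - sstep (lam * (z - h))).

(** With F c z the positive part of z - c, this is the piecewise linear function that rises by 1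
    over [s, s + w] and falls by 1 over [s', s' + w']; with F c z the indicator of c < z, it is the
    derivative. The parameter F covers these two limits and their smooth versions. *)
Definition trapezoid (F : R -> R -> R) s w s' w' z : R :=
  (F s z - F (s + w) z) / w - (F s' z - F (s' + w') z) / w'.

Definition sramp lam c z : R := ramp (lam * (z - c)) / lam.
Definition dsramp lam c z : R := dramp (lam * (z - c)).

Lemma cutoff_norm lam l h z : `|cutoff lam l h z| <= 1.
Proof.
rewrite /cutoff normrM mulr_ile1// ger0_norm ?sstep_ge0 ?sstep_le1// ?subr_ge0 ?sstep_le1//.
by rewrite gerBl sstep_ge0.
Qed.

Lemma cutoff_lo lam l h z : 0 < lam -> z <= l -> cutoff lam l h z = 0.
Proof.
by move=> l0 zl; rewrite /cutoff sstep_le0 ?mul0r// pmulr_rle0// subr_le0.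
Qed.

Lemma cutoff_hi lam l h z : 1 <= lam * (z - h) -> cutoff lam l h z = 0.
Proof. by move=> H; rewrite /cutoff [sstep (_ * (z - h))]sstep_ge1// subrr mulr0. Qed.

Lemma sramp_lo lam c z : 0 < lam -> z <= c -> sramp lam c z = 0.
Proof. by move=> l0 zc; rewrite /sramp ramp_le0 ?mul0r// pmulr_rle0// subr_le0. Qed.

Lemma sramp_hi lam c z : 0 < lam -> 1 <= lam * (z - c) -> sramp lam c z = z - c.
Proof. by move=> l0 H; rewrite /sramp ramp_ge1// mulrC mulKf// gt_eqF. Qed.

Lemma sramp_norm lam c z : 0 < lam -> `|sramp lam c z| <= `|z - c|.
Proof.
move=> l0; rewrite /sramp normrM normfV (gtr0_norm l0) ler_pdivrMr//.
by apply: le_trans (ramp_norm _) _; rewrite normrM (gtr0_norm l0) mulrC.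
Qed.

Lemma dsramp_lo lam c z : 0 < lam -> z <= c -> dsramp lam c z = 0.
Proof. by move=> l0 zc; rewrite /dsramp dramp_le0// pmulr_rle0// subr_le0. Qed.

Lemma dsramp_hi lam c z : 1 < lam * (z - c) -> dsramp lam c z = 1.
Proof. by move=> H; rewrite /dsramp dramp_gt1. Qed.

Lemma trapezoid_eq0 (F : R -> R -> R) s w s' w' z : (forall c, (c = s \/ c = s + w) \/ (c = s' \/ c = s' + w') -> F c z = 0) ->
  trapezoid F s w s' w' z = 0.
Proof. by move=> H; rewrite /trapezoid !H ?subrr ?mul0r ?subrr//; tauto. Qed.

Lemma trapezoid_norm (F : R -> R -> R) s w s' w' z L : 0 < w -> 0 < w' ->
  (forall c, (c = s \/ c = s + w) \/ (c = s' \/ c = s' + w') -> `|F c z| <= L) ->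
  `|trapezoid F s w s' w' z| <= (L + L) / w + (L + L) / w'.
Proof.
move=> w0 w0' H; rewrite /trapezoid; apply: le_trans (ler_normB _ _) _.
rewrite !normrM !normfV (gtr0_norm w0) (gtr0_norm w0').
apply: lerD; rewrite ler_pM2r ?invr_gt0//; apply: le_trans (ler_normB _ _) _;
  by apply: lerD; apply: H; tauto.
Qed.

Lemma scale_eventually (L u : R) : 0 < u -> \forall n \near \oo, 1 < (L + n%:R) * u.
Proof.
move=> u0; near=> n; rewrite -ltr_pdivrMr// mul1r -ltrBlDl.
near: n; exact: nbhs_infty_gtr.
Unshelve. all: by end_near. Qed.

(** At each point the limit is reached, not merely approached, so limits of sums, products and
    quotients of such functions are obtained by substitution. *)
Lemma cutoff_eventually L l h z : 0 < L ->
  \forall n \near \oo, cutoff (L + n%:R) l h z = (l < z <= h)%R%:R.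
Proof.
move=> L0; have Ln n : 0 < L + n%:R by rewrite ltr_wpDr.
have [zl|lz] := leP z l; first by near=> n; rewrite cutoff_lo.
have [zh|hz] := leP z h => /=; last first.
  near=> n; rewrite cutoff_hi//; apply/ltW; near: n.
  by apply: scale_eventually; rewrite subr_gt0.
near=> n; rewrite /cutoff sstep_ge1 ?mul1r; last first.
  by apply/ltW; near: n; apply: scale_eventually; rewrite subr_gt0.
by rewrite sstep_le0 ?subr0// pmulr_rle0// subr_le0.
Unshelve. all: by end_near. Qed.

Lemma sramp_eventually L c z : 0 < L ->
  \forall n \near \oo, sramp (L + n%:R) c z = Num.max (z - c) 0.
Proof.
move=> L0; have Ln n : 0 < L + n%:R by rewrite ltr_wpDr.
have [zc|cz] := leP z c.
  by near=> n; rewrite sramp_lo// max_r// subr_le0.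
near=> n; rewrite sramp_hi//; first by rewrite max_l// subr_ge0 ltW.
by apply/ltW; near: n; apply: scale_eventually; rewrite subr_gt0.
Unshelve. all: by end_near. Qed.

Lemma dsramp_eventually L c z : 0 < L ->
  \forall n \near \oo, dsramp (L + n%:R) c z = (c < z)%R%:R.
Proof.
move=> L0; have Ln n : 0 < L + n%:R by rewrite ltr_wpDr.
have [zc|cz] := leP z c; first by near=> n; rewrite dsramp_lo.
near=> n; rewrite dsramp_hi//.
by near: n; apply: scale_eventually; rewrite subr_gt0.
Unshelve. all: by end_near. Qed.

Lemma trapezoid_eventually (F : nat -> R -> R -> R) (G : R -> R -> R) s w s' w' z :
  (forall c, \forall n \near \oo, F n c z = G c z) ->
  \forall n \near \oo, trapezoid (F n) s w s' w' z = trapezoid G s w s' w' z.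
Proof.
move=> H; near=> n; rewrite /trapezoid.
have -> : F n s z = G s z by near: n; exact: H.
have -> : F n (s + w) z = G (s + w) z by near: n; exact: H.
have -> : F n s' z = G s' z by near: n; exact: H.
have -> : F n (s' + w') z = G (s' + w') z by near: n; exact: H.
by [].
Unshelve. all: by end_near. Qed.

End Cutoff.

Section TestFunction.
Variables (R : realType) (d : nat).
Implicit Types (lam s w L : R) (lo hi : 'rV[R]_d) (i : 'I_d).

(* The closed box [lo, hi] lies in O with some room above, where the smooth
   approximations of the indicator of the half-open box live. *)
Definition slack (O : set 'rV[R]_d) lo hi := exists2 eta : R, 0 < eta &
  forall x : 'rV[R]_d, (forall j, lo 0 j <= x 0 j <= hi 0 j + eta) -> O x.

Definition cross_cutoff lam lo hi i (x : 'rV[R]_d) : R :=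
  \prod_(j < d | j != i) cutoff lam (lo 0 j) (hi 0 j) (x 0 j).

Definition bump lam lo hi i s w s' w' (x : 'rV[R]_d) : R :=
  trapezoid (sramp lam) s w s' w' (x 0 i) * cross_cutoff lam lo hi i x.

Definition dbump lam lo hi i s w s' w' (x : 'rV[R]_d) : R :=
  trapezoid (dsramp lam) s w s' w' (x 0 i) * cross_cutoff lam lo hi i x.

Lemma is_derive_line_cst (X : normedModType R) (f : X -> R) (x v : X) :
  (forall t : R, f (t *: v + x) = f x) -> is_derive x v f 0.
Proof.
move=> H.
have E : (fun h : R => h^-1 *: ((f \o shift x) (h *: v) - f x)) = fun=> 0.
  by apply/funext => h /=; rewrite H subrr scaler0.
apply: DeriveDef; first by rewrite /derivable E; exact: is_cvg_cst.
by rewrite /derive E; exact: lim_cst.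
Qed.

Lemma is_derive_sramp lam c (x : 'rV[R]_d) i : lam != 0 ->
  is_derive x (ebasis R i) (fun y : 'rV[R]_d => sramp lam c (y 0 i)) (dsramp lam c (x 0 i)).
Proof.
move=> l0.
have d0 : is_derive x (ebasis R i) (fun y : 'rV[R]_d => y 0 i) 1.
  by have := is_derive_coord x i i; rewrite eqxx.
have d1 : is_derive (x 0 i : R) 1 (fun z : R => lam * (z - c)) lam.
  have H := is_deriveZ lam (is_deriveB (is_derive_id (x 0 i : R) (1 : R)) (is_derive_cst c (x 0 i : R) (1 : R))).
  by apply: is_derive_eq H _; rewrite subr0 [LHS]mulr1.
have d2 := is_derive_comp1 d0 (is_derive_comp1 d1 (is_derive_ramp _)).
have d3 := is_deriveM d2 (is_derive_cst lam^-1 x (ebasis R i)).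
apply: is_derive_eq d3 _.
by rewrite scaler0 add0r /GRing.scale/= mulr1 mulrC mulfK.
Qed.

Lemma is_derive_bump lam lo hi i s w s' w' x : lam != 0 ->
  is_derive x (ebasis R i) (bump lam lo hi i s w s' w') (dbump lam lo hi i s w s' w' x).
Proof.
move=> l0.
have dP : is_derive x (ebasis R i) (cross_cutoff lam lo hi i) 0.
  apply: is_derive_line_cst => t; apply: eq_bigr => j ji.
  by rewrite !mxE (negbTE ji) /= mulr0 add0r.
have dr c := is_derive_sramp c x i l0.
have dsub c c' v := is_deriveM (is_deriveB (dr c) (dr c')) (is_derive_cst v x (ebasis R i)).
have d1 := is_deriveM (is_deriveB (dsub s (s + w) w^-1) (dsub s' (s' + w') w'^-1)) dP.
apply: is_derive_eq d1 _.
by rewrite /dbump /trapezoid /GRing.scale/=; ring.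
Qed.

Lemma Cn_affine_comp (X : normedModType R) (I : Type) (e : I -> X) n (phi : R -> R)
  (h : X -> R) lam c : Cn1 n setT phi -> Cn e n setT h ->
  Cn e n setT (fun x => phi (lam * (h x - c))).
Proof.
move=> Cp Ch; apply: (@Cn_comp _ _ _ _ _ setT) => //.
apply: Cn_mul; first exact: Cn_cst.
by apply: Cn_add => //; exact: Cn_cst.
Qed.

Lemma Cn_opp (X : normedModType R) (I : Type) (e : I -> X) n U (h : X -> R) :
  Cn e n U h -> Cn e n U (fun x => - h x).
Proof.
move=> Ch; under eq_fun do rewrite -mulN1r.
by apply: Cn_mul => //; exact: Cn_cst.
Qed.

Lemma Cn_bump n lam lo hi i s w s' w' :
  Cn (@ebasis R d) n setT (bump lam lo hi i s w s' w').
Proof.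
have Cr c : Cn (@ebasis R d) n setT (fun x : 'rV[R]_d => sramp lam c (x 0 i)).
  apply: Cn_mul; last exact: Cn_cst.
  by apply: Cn_affine_comp; [exact: Cn1_ramp|exact: Cn_coord].
have Ct c c' v : Cn (@ebasis R d) n setT (fun x : 'rV[R]_d => (sramp lam c (x 0 i) - sramp lam c' (x 0 i)) / v).
  apply: Cn_mul; last exact: Cn_cst.
  by apply: Cn_add => //; exact: Cn_opp.
apply: Cn_mul; first by apply: Cn_add => //; exact: Cn_opp.
apply: Cn_prod => j; apply: Cn_mul.
  by apply: Cn_affine_comp; [exact: Cn1_sstep|exact: Cn_coord].
apply: Cn_add; first exact: Cn_cst.
by apply: Cn_opp; apply: Cn_affine_comp; [exact: Cn1_sstep|exact: Cn_coord].
Qed.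

Section Support.
Variables (lo hi : 'rV[R]_d) (i : 'I_d) (s w s' w' : R).
Hypotheses (w0 : 0 < w) (w0' : 0 < w') (los : lo 0 i <= s) (los' : lo 0 i <= s')
  (shi : s + w <= hi 0 i) (shi' : s' + w' <= hi 0 i).

Let node c := (c = s \/ c = s + w) \/ (c = s' \/ c = s' + w').

Let node_itv c : node c -> lo 0 i <= c <= hi 0 i.
Proof.
have := (w0, w0', los, los', shi, shi') => -[[[[[a1 a2] a3] a4] a5] a6].
by rewrite /node => -[[]|[]] ->; apply/andP; split; lra.
Qed.

(** Above all the nodes both quotients equal 1 and cancel: the divisions by w and w' give the bump
    its compact support. *)
Lemma trapezoid_hi (F : R -> R -> R) z : (forall c, node c -> F c z = z - c) ->
  trapezoid F s w s' w' z = 0.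
Proof.
move=> H; rewrite /trapezoid !H /node; try tauto.
have -> : z - s - (z - (s + w)) = w by ring.
have -> : z - s' - (z - (s' + w')) = w' by ring.
by rewrite !divff ?gt_eqF// subrr.
Qed.

Lemma trapezoid_hi1 (F : R -> R -> R) z : (forall c, node c -> F c z = 1) ->
  trapezoid F s w s' w' z = 0.
Proof. by move=> H; rewrite /trapezoid !H /node ?subrr ?mul0r ?subrr//; tauto. Qed.

Lemma bump_support lam (eta : R) (x : 'rV[R]_d) : 0 < lam -> 1 <= lam * eta ->
  ~ (forall j, lo 0 j < x 0 j <= hi 0 j + eta) ->
  bump lam lo hi i s w s' w' x = 0.
Proof.
move=> l0 le /existsNP[j /negP].
rewrite negb_and -leNgt -ltNge => /orP jx.
have big z c : c + eta <= z -> 1 <= lam * (z - c).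
  by move=> cz; apply: le_trans le _; rewrite ler_pM2l// lerBrDl.
have [ji|ji] := eqVneq j i; last first.
  rewrite /bump /cross_cutoff (bigD1 j)//=.
  rewrite (_ : cutoff _ _ _ _ = 0) ?mul0r ?mulr0//; case: jx => jx; first exact: cutoff_lo.
  by apply/cutoff_hi/big/ltW.
rewrite ji in jx; rewrite /bump (_ : trapezoid _ _ _ _ _ _ = 0) ?mul0r//.
case: jx => jx.
  apply: trapezoid_eq0 => c /node_itv/andP[h1 h2]; apply: sramp_lo => //.
  exact: le_trans jx h1.
apply: trapezoid_hi => c /node_itv/andP[h1 h2]; apply: sramp_hi => //; apply: big.
by apply: ltW; apply: le_lt_trans jx; rewrite lerD2r.
Qed.

Lemma dbump_support lam (eta : R) (x : 'rV[R]_d) : 0 < lam -> 1 <= lam * eta ->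
  ~ (forall j, lo 0 j < x 0 j <= hi 0 j + eta) ->
  dbump lam lo hi i s w s' w' x = 0.
Proof.
move=> l0 le /existsNP[j /negP].
rewrite negb_and -leNgt -ltNge => /orP jx.
have big z c : c + eta < z -> 1 < lam * (z - c).
  by move=> cz; apply: le_lt_trans le _; rewrite ltr_pM2l// ltrBrDl.
have [ji|ji] := eqVneq j i; last first.
  rewrite /dbump /cross_cutoff (bigD1 j)//=.
  rewrite (_ : cutoff _ _ _ _ = 0) ?mul0r ?mulr0//; case: jx => jx; first exact: cutoff_lo.
  by apply/cutoff_hi/ltW/big.
rewrite ji in jx; rewrite /dbump (_ : trapezoid _ _ _ _ _ _ = 0) ?mul0r//.
case: jx => jx.
  apply: trapezoid_eq0 => c /node_itv/andP[h1 h2]; apply: dsramp_lo => //.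
  exact: le_trans jx h1.
apply: trapezoid_hi1 => c /node_itv/andP[h1 h2]; apply: dsramp_hi => //; apply: big.
by apply: le_lt_trans jx; rewrite lerD2r.
Qed.

Lemma test_fun_bump O lam (eta : R) : 0 < lam -> 1 <= lam * eta ->
  (forall x : 'rV[R]_d, (forall j, lo 0 j <= x 0 j <= hi 0 j + eta) -> O x) ->
  test_fun O (bump lam lo hi i s w s' w').
Proof.
move=> l0 le HO; split.
  by apply: Cn_smooth_on; [exact: openT|move=> n; exact: Cn_bump].
pose K := [set x : 'rV[R]_d | forall j, `[lo 0 j, hi 0 j + eta]%classic (x 0 j)].
exists K; split.
- exact: (rV_compact (fun j => @segment_compact R (lo 0 j) (hi 0 j + eta))).
- by move=> x Kx; apply: HO => j; have := Kx j; rewrite /= in_itv.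
- move=> x nKx; apply: (bump_support l0 le) => H; apply: nKx => j.
  by rewrite /= in_itv/=; have /andP[h1 h2] := H j; rewrite (ltW h1).
Qed.

Lemma cross_cutoff_norm lam (x : 'rV[R]_d) : `|cross_cutoff lam lo hi i x| <= 1.
Proof.
by rewrite /cross_cutoff normr_prod; apply: prodr_ile1 => j _; rewrite normr_ge0 cutoff_norm.
Qed.

(** The bound is uniform in lam, for use in dominated convergence. As lam >= 1, the bump lives
    within distance 1 above the box, where each ramp is at most L. *)
Lemma bump_bound : exists K : R, forall lam (x : 'rV[R]_d), 1 <= lam ->
  `|bump lam lo hi i s w s' w' x| <= K /\ `|dbump lam lo hi i s w s' w' x| <= K.
Proof.
have [C HC] := dramp_bound R.
pose L := hi 0 i + 1 - lo 0 i.
pose K1 := (L + L) / w + (L + L) / w'; pose K2 := (C + C) / w + (C + C) / w'.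
have L0 : 0 <= L.
  by have := (w0, los, shi) => -[[a1 a2] a3]; rewrite /L; lra.
have K10 : 0 <= K1.
  apply: addr_ge0; apply: divr_ge0; try apply: addr_ge0; try exact: ltW; try exact: L0.
exists (Num.max K1 K2) => lam x l1; have l0 : 0 < lam := lt_le_trans ltr01 l1.
rewrite !le_max; split; apply/orP; [left|right].
  have [H|H] := pselect (forall j, lo 0 j < x 0 j <= hi 0 j + 1); last first.
    by rewrite (bump_support l0 _ H) ?normr0// mulr1.
  rewrite /bump normrM; apply: le_trans (ler_piMr (normr_ge0 _) (cross_cutoff_norm _ _)) _.
  apply: trapezoid_norm => // c /node_itv/andP[h1 h2]; apply: le_trans (sramp_norm _ _ l0) _.
  have /andP[h3 h4] := H i; rewrite ler_norml /L; apply/andP; split; lra.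
rewrite /dbump normrM; apply: le_trans (ler_piMr (normr_ge0 _) (cross_cutoff_norm _ _)) _.
by apply: trapezoid_norm => // c _; exact: HC.
Qed.

End Support.

Definition bump_limit (F : R -> R -> R) lo hi i s w s' w' (x : 'rV[R]_d) : R :=
  trapezoid F s w s' w' (x 0 i) * \prod_(j < d | j != i) (lo 0 j < x 0 j <= hi 0 j)%R%:R.

Lemma cross_cutoff_eventually L lo hi i (x : 'rV[R]_d) : 0 < L ->
  \forall n \near \oo, cross_cutoff (L + n%:R) lo hi i x =
    \prod_(j < d | j != i) (lo 0 j < x 0 j <= hi 0 j)%R%:R.
Proof.
move=> L0; have H : \forall n \near \oo, forall j : 'I_d,
    cutoff (L + n%:R) (lo 0 j) (hi 0 j) (x 0 j) = (lo 0 j < x 0 j <= hi 0 j)%R%:R.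
  apply: filter_forall => j; exact: cutoff_eventually.
near=> n; apply: eq_bigr => j _; move: j; near: n; exact: H.
Unshelve. all: by end_near. Qed.

Lemma bump_eventually L lo hi i s w s' w' x : 0 < L ->
  \forall n \near \oo, bump (L + n%:R) lo hi i s w s' w' x =
    bump_limit (fun c z => Num.max (z - c) 0) lo hi i s w s' w' x.
Proof.
move=> L0; near=> n; rewrite /bump /bump_limit; congr (_ * _).
  near: n; apply: trapezoid_eventually => c; exact: sramp_eventually.
near: n; exact: cross_cutoff_eventually.
Unshelve. all: by end_near. Qed.

Lemma dbump_eventually L lo hi i s w s' w' x : 0 < L ->
  \forall n \near \oo, dbump (L + n%:R) lo hi i s w s' w' x =
    bump_limit (fun c z => (c < z)%R%:R) lo hi i s w s' w' x.
Proof.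
move=> L0; near=> n; rewrite /dbump /bump_limit; congr (_ * _).
  near: n; apply: trapezoid_eventually => c; exact: dsramp_eventually.
near: n; exact: cross_cutoff_eventually.
Unshelve. all: by end_near. Qed.

End TestFunction.

(** * Averages over boxes of a function with bounded weak derivatives *)

Section WeakDerivativeBox.
Variables (R : realType) (d : nat).
Notation T := (Rd R d).
Variable mu : {measure set T -> \bar R}.
Hypothesis leb : is_lebesgue mu.
Variable O : set 'rV[R]_d.

Definition weak_pd (f a : T -> R) (i : 'I_d) := forall phi, test_fun O phi ->
  (\int[mu]_x (f x * 'D_(ebasis R i) phi x)%:E =
   - \int[mu]_x (a x * phi x)%:E)%E.

Variables (f a : T -> R) (i : 'I_d) (M : R).
Hypotheses (mf : measurable_fun setT f) (ma : measurable_fun setT a)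
  (fM : forall x, `|f x| <= M) (aM : forall x, `|a x| <= M) (wfa : weak_pd f a i).

Section Trapezoid.
Variables (lo hi : 'rV[R]_d) (s w s' w' : R).
Hypotheses (w0 : 0 < w) (w0' : 0 < w') (los : lo 0 i <= s) (los' : lo 0 i <= s')
  (shi : s + w <= hi 0 i) (shi' : s' + w' <= hi 0 i).
Hypothesis lohi : forall j, lo 0 j <= hi 0 j.
Hypothesis slk : slack O lo hi.

Let hi1 : 'rV[R]_d := \row_j (hi 0 j + 1).
Let ind (c z : R) : R := (c < z)%R%:R.
Let pos (c z : R) : R := Num.max (z - c) 0.

Lemma weak_pd_limit (D : set T) : D = box lo hi1 ->
  (\int[mu]_(x in D) (f x * bump_limit ind lo hi i s w s' w' x)%:E =
    - \int[mu]_(x in D) (a x * bump_limit pos lo hi i s w s' w' x)%:E)%E /\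
  measurable_fun D (bump_limit pos lo hi i s w s' w' : T -> R).
Proof.
move=> DE; have mD : measurable D by rewrite DE; exact: measurable_box.
have [eta e0 HO] := slk.
(* L >= 1 keeps the supports in D and gives the uniform bound; L >= 1/eta keeps them in O, so that
   the bumps are test functions. *)
pose L : R := Num.max 1 eta^-1.
have L1 : 1 <= L by rewrite /L le_max lexx.
have L0 : 0 < L := lt_le_trans ltr01 L1.
have Ln1 n : 1 <= L + n%:R by rewrite (le_trans L1)// lerDl.
have Ln0 n : 0 < L + n%:R := lt_le_trans ltr01 (Ln1 n).
have Lne n : 1 <= (L + n%:R) * eta.
  rewrite -ler_pdivrMr// mul1r; apply: (@le_trans _ _ L); last by rewrite lerDl.
  by rewrite /L le_max lexx orbT.
pose t n : T -> R := bump (L + n%:R) lo hi i s w s' w'.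
pose dt n : T -> R := dbump (L + n%:R) lo hi i s w s' w'.
have dtE n (x : 'rV[R]_d) : 'D_(ebasis R i) (t n : 'rV[R]_d -> R) x = dt n x.
  by have [_ ->] := is_derive_bump lo hi i s w s' w' x (lt0r_neq0 (Ln0 n)).
have mt n : measurable_fun setT (t n).
  apply: (@measurable_continuous_Rd _ _ setT); first exact: openT.
  exact: (Cn_continuous (Cn_bump 0 _ _ _ _ _ _ _ _)).
have mdt n : measurable_fun setT (dt n).
  have [_ /(_ i)[t' [t'd t'c]]] := Cn_bump 1 (L + n%:R) lo hi i s w s' w'.
  have E : t' = (dt n : 'rV[R]_d -> R).
    by apply/funext => x; rewrite -dtE; have [_ ->] := t'd x Logic.I.
  have ct' := t'c.1; rewrite E in ct'.
  exact: (measurable_continuous_Rd openT ct').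
have outD n x : ~ D x -> t n x = 0 /\ dt n x = 0.
  move=> nD; have nD' : ~ (forall j, lo 0 j < (x : 'rV[R]_d) 0 j <= hi 0 j + 1).
    by move=> H; apply: nD; rewrite DE => j; rewrite mxE; exact: H.
  split; [apply: (bump_support w0 w0' los los' shi shi' (Ln0 n) (eta := 1)) => //|
          apply: (dbump_support w0 w0' los los' shi shi' (Ln0 n) (eta := 1)) => //];
  by rewrite mulr1.
have toD (h g : T -> R) : (forall x, ~ D x -> g x = 0) ->
    (\int[mu]_x (h x * g x)%:E = \int[mu]_(x in D) (h x * g x)%:E)%E.
  move=> g0; rewrite [RHS]integral_mkcond; apply: eq_integral => x _.
  rewrite patchE; case: ifPn => // /negP xD.
  by rewrite g0 ?mulr0// => Dx; apply: xD; rewrite inE.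
have idn n : (\int[mu]_(x in D) (f x * dt n x)%:E = - \int[mu]_(x in D) (a x * t n x)%:E)%E.
  have tt : test_fun O (t n).
    exact: (test_fun_bump w0 w0' los los' shi shi' (Ln0 n) (Lne n) HO).
  rewrite -(toD a (t n)); last by move=> x /(outD n)[].
  rewrite -(toD f (dt n)); last by move=> x /(outD n)[].
  by rewrite -wfa//; apply: eq_integral => x _; rewrite dtE.
have [K HK] := bump_bound w0 w0' los los' shi shi'.
have M0 : 0 <= M := le_trans (normr_ge0 _) (fM point).
have dct (h : T -> R) (u : nat -> T -> R) (v : T -> R) : measurable_fun setT h ->
    (forall x, `|h x| <= M) -> (forall n, measurable_fun setT (u n)) ->
    (forall n x, `|u n x| <= K) -> (forall x, \forall n \near \oo, u n x = v x) ->
    (\int[mu]_(x in D) (h x * u n x)%:E @[n --> \oo] --> \int[mu]_(x in D) (h x * v x)%:E)%E /\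
    measurable_fun D v.
  move=> mh hM mu_ uK uv.
  have mv : measurable_fun D v.
    apply: (@measurable_fun_cvg _ _ _ _ u) => [n|x _].
      exact: measurable_funTS.
    apply: cvg_near_cst; exact: uv.
  split => //.
  have H := @dominated_convergence _ _ _ mu D mD (fun n x => (h x * u n x)%:E)
    (fun x => (h x * v x)%:E) (fun=> (M * K)%:E).
  have [//|||||_ _ //] := H.
  - move=> n; apply/measurable_EFinP; apply: measurable_funM; exact: measurable_funTS.
  - by apply/measurable_EFinP; apply: measurable_funM => //; exact: measurable_funTS.
  - apply: aeW => x Dx; apply: cvg_near_cst.
    by apply: filterS (uv x) => n ->.
  - rewrite DE; apply: (integrable_box leb (M := `|M * K|)) => //.
  - by apply: aeW => x n Dx; rewrite abse_EFin lee_fin normrM ler_pM.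
have [c1 _] := dct f dt _ mf fM mdt (fun n x => (HK _ x (Ln1 n)).2)
  (fun x => dbump_eventually lo hi i s w s' w' x L0).
have [c2 mv] := dct a t _ ma aM mt (fun n x => (HK _ x (Ln1 n)).1)
  (fun x => bump_eventually lo hi i s w s' w' x L0).
split => //.
have E : (fun n => \int[mu]_(x in D) (f x * dt n x)%:E)%E =
    (fun n => - \int[mu]_(x in D) (a x * t n x)%:E)%E.
  by apply/funext => n; exact: idn.
have c3 : (- \int[mu]_(x in D) (a x * t n x)%:E)%E @[n --> \oo] -->
    (- \int[mu]_(x in D) (a x * bump_limit pos lo hi i s w s' w' x)%:E)%E by exact: cvgeN.
rewrite -E in c3.
exact: (cvg_unique (@ereal_hausdorff R) c1 c3).
Qed.


Let V : R := \prod_(j < d | j != i) (hi 0 j - lo 0 j).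
Let Bs := box (updrow lo i s) (updrow hi i (s + w)).
Let Bs' := box (updrow lo i s') (updrow hi i (s' + w')).
Let B := box lo hi.

Lemma box_updrowP p q (x : 'rV[R]_d) : box (updrow lo i p) (updrow hi i q) x <->
  p < x 0 i <= q /\ forall j, j != i -> lo 0 j < x 0 j <= hi 0 j.
Proof.
split => [H|[H1 H2] j].
  by split => [|j ji]; [have := H i; rewrite !updrowE|have := H j; rewrite !updrow_neq].
by have [->|ji] := eqVneq j i; [rewrite !updrowE|rewrite !updrow_neq//; exact: H2].
Qed.

Lemma cross01 (x : 'rV[R]_d) : \prod_(j < d | j != i) (lo 0 j < x 0 j <= hi 0 j)%R%:R =
  `[< forall j, j != i -> lo 0 j < x 0 j <= hi 0 j >]%:R :> R.
Proof.
case: asboolP => [H|/existsNP[j /not_implyP[ji /negP nj]]].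
  by rewrite big1// => j ji; rewrite H.
by rewrite (bigD1 j)//= (negbTE nj) mul0r.
Qed.

Lemma bump_limit_ind (x : 'rV[R]_d) : bump_limit ind lo hi i s w s' w' x =
  \1_Bs (x : T) / w - \1_Bs' (x : T) / w'.
Proof.
have H p v : 0 < v -> ((ind p (x 0 i) - ind (p + v) (x 0 i)) / v) *
    `[< forall j, j != i -> lo 0 j < x 0 j <= hi 0 j >]%:R =
    \1_(box (updrow lo i p) (updrow hi i (p + v))) (x : T) / v.
  move=> v0; rewrite mulrAC; congr (_ / _); rewrite indicE.
  case: asboolP => [H|nH]; last first.
    by rewrite mulr0 memNset// => /box_updrowP[_ /nH].
  rewrite mulr1 /ind; have pv : p < p + v by rewrite ltrDl.
  have [xp|px] := leP (x 0 i) p.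
    rewrite (le_gtF (le_trans xp (ltW pv))) subr0 memNset// => /box_updrowP[/andP[+ _] _].
    by rewrite ltNge xp.
  have [xv|vx] := leP (x 0 i) (p + v).
    by rewrite subr0 mem_set//; apply/box_updrowP; rewrite px xv.
  rewrite subrr memNset// => /box_updrowP[/andP[_ +] _].
  by rewrite leNgt vx.
by rewrite /bump_limit /trapezoid cross01 mulrBl !H.
Qed.

(** Squeezing the ramp between two step functions reduces its integral to volumes of boxes, at the
    price of an error of order v. *)
Lemma pos_ratio (p v z : R) : 0 < v ->
  (p + v < z)%R%:R <= (pos p z - pos (p + v) z) / v <= (p < z)%R%:R.
Proof.
move=> v0; rewrite ler_pdivlMr// ler_pdivrMr// /pos.
have [zp|pz] := leP z p.
  rewrite (_ : (p + v < z) = false); last by apply/le_gtF; lra.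
  by rewrite !max_r ?subrr ?mul0r ?lexx//; lra.
have [zv|vz] := leP z (p + v).
  rewrite mul0r mul1r max_l; last by lra.
  by rewrite max_r; [apply/andP; split; lra|lra].
by rewrite !mul1r !max_l; [apply/andP; split; lra|lra|lra].
Qed.

Lemma bump_limit_pos_out (x : 'rV[R]_d) : ~ B (x : T) -> bump_limit pos lo hi i s w s' w' x = 0.
Proof.
move=> nB; rewrite /bump_limit cross01; case: asboolP => [H|_]; last by rewrite mulr0.
have : ~ (lo 0 i < x 0 i <= hi 0 i).
  by move=> Hi; apply: nB => j; have [->//|ji] := eqVneq j i; exact: H.
have := (w0, w0', los, los', shi, shi') => -[[[[[a1 a2] a3] a4] a5] a6].
move=> /negP; rewrite negb_and -leNgt -ltNge => /orP[h|h].
  rewrite trapezoid_eq0 ?mul0r// => c Hc; rewrite /pos max_r//.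
  by case: Hc => -[] ->; lra.
rewrite (trapezoid_hi w0 w0') ?mul0r// => c Hc; rewrite /pos max_l//.
by case: Hc => -[] ->; lra.
Qed.

Lemma bump_limit_pos_in (x : 'rV[R]_d) : B (x : T) ->
  (s + w < x 0 i)%R%:R - (s' < x 0 i)%R%:R <= bump_limit pos lo hi i s w s' w' x /\
  bump_limit pos lo hi i s w s' w' x <= (s < x 0 i)%R%:R - (s' + w' < x 0 i)%R%:R.
Proof.
move=> Bx; rewrite /bump_limit cross01 asboolT ?mulr1; last by move=> j _; exact: Bx.
have /andP[h1 h2] := pos_ratio s (x 0 i) w0.
have /andP[h3 h4] := pos_ratio s' (x 0 i) w0'.
by rewrite /trapezoid; split; lra.
Qed.

Lemma bump_limit_pos_norm (x : 'rV[R]_d) : B (x : T) -> `|bump_limit pos lo hi i s w s' w' x| <= 1.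
Proof.
move=> /bump_limit_pos_in[h1 h2]; rewrite ler_norml.
have P (b : bool) : 0 <= b%:R :> R by case: b.
have Q (b : bool) : b%:R <= 1 :> R by case: b.
have := (P (s + w < x 0 i)%R, P (s' + w' < x 0 i)%R, Q (s' < x 0 i)%R, Q (s < x 0 i)%R).
by move=> [[[q1 q2] q3] q4]; apply/andP; split; lra.
Qed.

Lemma integral_above c : lo 0 i <= c <= hi 0 i ->
  \int[mu]_(x in B) (c < (x : 'rV[R]_d) 0 i)%R%:R = (hi 0 i - c) * V.
Proof.
move=> /andP[h1 h2]; pose E := box (updrow lo i c) (updrow hi i (hi 0 i)).
have EB : E `<=` B.
  by apply: box_sub => j; rewrite mxE; case: eqVneq => [->|].
rewrite (@eq_Rintegral _ _ _ _ _ (\1_E)); last first.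
  move=> x; rewrite inE => Bx; rewrite indicE; congr (_%:R); congr nat_of_bool.
  apply/idP/idP => [cx|].
    apply/mem_set/box_updrowP; split; first by have /andP[_ ->] := Bx i; rewrite cx.
    by move=> j _; exact: Bx.
  by move=> /set_mem/box_updrowP[/andP[]].
rewrite /Rintegral integral_indic; [|exact: measurable_box|exact: measurable_box].
rewrite (setIidl EB) mu_box ?vol_updrow//.
by move=> j; rewrite !mxE; case: eqVneq.
Qed.

(** For the trapezoid t, the weak derivative identity says that the difference of the two normalized
    integrals of f is minus the integral of a t. Since |t| <= 1, replacing a by al costs eps times
    the volume of B; the integral of t is (s' - s) V up to (w + w') V. *)
Lemma trapezoid_estimate al eps : (forall x, B x -> `|a x - al| <= eps) ->
  `|(\int[mu]_(x in Bs) f x) / w - (\int[mu]_(x in Bs') f x) / w' + al * (s' - s) * V|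
  <= (eps * (hi 0 i - lo 0 i) + `|al| * (w + w')) * V.
Proof.
move=> aal.
have [[[[[a1 a2] a3] a4] a5] a6] := (w0, w0', los, los', shi, shi').
have V0 : 0 <= V by apply: prodr_ge0 => j _; rewrite subr_ge0.
pose D := box lo hi1.
have [E mt] := weak_pd_limit erefl; rewrite -/D in E mt.
pose t : T -> R := bump_limit pos lo hi i s w s' w'; rewrite -/t in E mt.
have BD : B `<=` D by apply: box_sub => j //; rewrite mxE; lra.
have mB : measurable B by exact: measurable_box.
have mD : measurable D by exact: measurable_box.
have mtB : measurable_fun B t by exact: measurable_funS mt.
have tB x : B x -> `|t x| <= 1 by exact: bump_limit_pos_norm.
have maB : measurable_fun B a by exact: measurable_funTS.
have itB : mu.-integrable B (EFin \o t) by apply: (integrable_box leb mtB tB).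
have icB r : mu.-integrable B (EFin \o (fun x : T => (r < (x : 'rV[R]_d) 0 i)%R%:R : R)).
  apply: (integrable_box leb (M := 1)); last by move=> x _; case: (_ < _) => /=; rewrite ?normr0 ?normr1.
  rewrite (_ : (fun x => _) = \1_((fun x : T => (x : 'rV[R]_d) 0 i) @^-1` `]r, +oo[%classic)); last first.
    apply/funext => x; rewrite indicE; congr (_%:R); congr nat_of_bool.
    by apply/idP/idP => [rx|/set_mem]; [apply/mem_set|]; rewrite /= in_itv/= ?andbT.
  apply: measurable_indic.
  by rewrite -[X in measurable X]setTI; exact: measurable_coord.
have intt : `|\int[mu]_(x in B) t x - (s' - s) * V| <= (w + w') * V.
  have U : \int[mu]_(x in B) t x <= (hi 0 i - s) * V - (hi 0 i - (s' + w')) * V.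
    rewrite -!integral_above -?RintegralB//; try (by apply/andP; split; lra).
    apply: le_Rintegral => //; first by have := integrableB mB (icB s) (icB (s' + w')).
    by move=> x /bump_limit_pos_in[].
  have L : (hi 0 i - (s + w)) * V - (hi 0 i - s') * V <= \int[mu]_(x in B) t x.
    rewrite -!integral_above -?RintegralB//; try (by apply/andP; split; lra).
    apply: le_Rintegral => //; first by have := integrableB mB (icB (s + w)) (icB s').
    by move=> x /bump_limit_pos_in[].
  have wV : 0 <= w * V by rewrite mulr_ge0// ltW.
  have wV' : 0 <= w' * V by rewrite mulr_ge0// ltW.
  by rewrite ler_norml; apply/andP; split; lra.
have Ea : \int[mu]_(x in D) (a x * t x) = \int[mu]_(x in B) (a x * t x).
  rewrite -[in RHS](setIidr BD) Rintegral_mkcondr; apply: eq_Rintegral => x _.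
  by rewrite patchE; case: ifPn => // /negP xB; rewrite /t bump_limit_pos_out ?mulr0// => /mem_set.
have Ef : \int[mu]_(x in D) (f x * bump_limit ind lo hi i s w s' w' x) =
    (\int[mu]_(x in Bs) f x) / w - (\int[mu]_(x in Bs') f x) / w'.
  have sub p v : p + v <= hi 0 i -> lo 0 i <= p -> box (updrow lo i p) (updrow hi i (p + v)) `<=` D.
    move=> h1 h2; apply: box_sub => j; rewrite !mxE; case: eqVneq => [->|_] //; lra.
  have H (A : set T) v : measurable A -> A `<=` D ->
     mu.-integrable D (EFin \o (fun x => f x * \1_A x / v)) /\
     \int[mu]_(x in D) (f x * \1_A x / v) = (\int[mu]_(x in A) f x) / v.
    move=> mA AD.
    have i1 : mu.-integrable D (EFin \o (fun x => f x * \1_A x)).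
      apply: (integrable_box leb (M := M)).
        by apply: measurable_funTS; apply: measurable_funM => //; exact: measurable_indic.
      move=> x _; rewrite normrM indicE; case: (_ \in _); rewrite ?normr1 ?mulr1// normr0 mulr0.
      exact: le_trans (normr_ge0 _) (fM point).
    split; first by have := integrableZr mD v^-1 i1.
    rewrite RintegralZr//; congr (_ / _).
    rewrite -[in RHS](setIidr AD) Rintegral_mkcondr; apply: eq_Rintegral => x _.
    by rewrite patchE indicE; case: ifPn => xA; rewrite ?(mem_set xA) ?mulr1 ?mulr0.
  have [i1 <-] := H Bs w (measurable_box _ _) (sub _ _ a5 a3).
  have [i2 <-] := H Bs' w' (measurable_box _ _) (sub _ _ a6 a4).
  rewrite -RintegralB//; apply: eq_Rintegral => x _.
  by rewrite bump_limit_ind mulrBr !mulrA.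
have ER : \int[mu]_(x in D) (f x * bump_limit ind lo hi i s w s' w' x) = - \int[mu]_(x in B) (a x * t x).
  by rewrite -Ea /Rintegral E fineN.
rewrite -Ef ER.
have -> : \int[mu]_(x in B) (a x * t x) =
    \int[mu]_(x in B) ((a x - al) * t x) + al * \int[mu]_(x in B) t x.
  have iat : mu.-integrable B (EFin \o (fun x => (a x - al) * t x)).
    apply: (integrable_box leb (M := eps)).
      by apply: measurable_funM => //; apply: measurable_funB.
    move=> x Bx; rewrite normrM; apply: le_trans (aal x Bx).
    by rewrite ler_piMr// tB.
  rewrite -RintegralZl// -RintegralD//; last by have := integrableZl mB al itB.
  by apply: eq_Rintegral => x _; ring.
have I1 : `|\int[mu]_(x in B) ((a x - al) * t x)| <= eps * vol lo hi.
  apply: (Rintegral_box_le leb) => //.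
    by apply: measurable_funM => //; apply: measurable_funB.
  move=> x Bx; rewrite normrM; apply: le_trans (aal x Bx).
  by rewrite ler_piMr// tB.
rewrite (volD1 _ _ i) -/V in I1.
set u := \int[mu]_(x in B) ((a x - al) * t x) in I1 *.
set v := \int[mu]_(x in B) t x in intt *.
have -> : - (u + al * v) + al * (s' - s) * V = - (u + al * (v - (s' - s) * V)) by ring.
rewrite normrN; apply: le_trans (ler_normD _ _) _; rewrite normrM [leRHS]mulrDl.
by apply: lerD; [rewrite -mulrA|rewrite -mulrA ler_wpM2l].
Qed.

End Trapezoid.
End WeakDerivativeBox.

Lemma continuous_eps (R : realType) (X : normedModType R) (g : X -> R) (x : X) :
  {for x, continuous g} <-> forall eps : R, 0 < eps ->
    exists2 rho : R, 0 < rho & forall y, `|x - y| < rho -> `|g x - g y| <= eps.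
Proof.
split=> [/cvgrPdist_le cg eps e0|H].
  have /nbhs_ballP[rho /= rho0 Hb] := cg eps e0.
  by exists rho => // y xy; apply: Hb; rewrite -ball_normE.
apply/cvgrPdist_le => eps e0; have [rho rho0 Hr] := H eps e0.
by apply/nbhs_ballP; exists rho => //= y; rewrite -ball_normE /= => /Hr.
Qed.

Section BoxAverages.
Variables (R : realType) (d : nat).
Implicit Types (lo hi p q u v x y : 'rV[R]_d).
Notation T := (Rd R d).
Variable mu : {measure set T -> \bar R}.
Hypothesis leb : is_lebesgue mu.
Variable O : set 'rV[R]_d.
Hypothesis oO : open O.
Variables (f : T -> R) (a : 'I_d -> T -> R) (M : R).
Hypotheses (mf : measurable_fun setT f) (ma : forall i, measurable_fun setT (a i))
  (fM : forall x, `|f x| <= M) (aM : forall i x, `|a i x| <= M)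
  (wfa : forall i, weak_pd mu O f (a i) i).

Definition avg p q : R := (\int[mu]_(x in box p q) f x) / vol p q.

Let M0 : 0 <= M. Proof. exact: le_trans (normr_ge0 _) (fM point). Qed.

Lemma slack_sub lo hi lo' hi' : slack O lo hi -> (forall j, lo 0 j <= lo' 0 j) ->
  (forall j, hi' 0 j <= hi 0 j) -> slack O lo' hi'.
Proof.
move=> [eta e0 HO] ll hh; exists eta => // x Hx; apply: HO => j.
by have /andP[h1 h2] := Hx j; rewrite (le_trans (ll j) h1) (le_trans h2)// lerD2r.
Qed.

Lemma slack_grow lo hi : slack O lo hi -> exists2 r : R, 0 < r &
  forall del : R, 0 <= del -> del <= r -> slack O lo (\row_j (hi 0 j + del)).
Proof.
move=> [eta e0 HO]; exists (eta / 2); first by rewrite divr_gt0.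
move=> del d0 dr; exists (eta / 2); first by rewrite divr_gt0.
move=> x Hx; apply: HO => j; have := Hx j; rewrite mxE => /andP[-> h]/=; lra.
Qed.

Lemma slack_nbhs x : O x -> exists2 r : R, 0 < r & forall lo hi,
  (forall j, x 0 j - r <= lo 0 j) -> (forall j, hi 0 j <= x 0 j + r) -> slack O lo hi.
Proof.
move=> Ox; have [r r0 rO] := open_cube oO Ox.
exists (r / 2); first by rewrite divr_gt0.
move=> lo hi hlo hhi; exists (r / 4); first by rewrite divr_gt0.
move=> y Hy; apply: rO => j; have /andP[h1 h2] := Hy j.
have := hlo j; have := hhi j => h3 h4.
by rewrite ltr_norml; apply/andP; split; lra.
Qed.

(** Lets del tend to 0 in estimates where g has been replaced by averages over cubes of side del, at
    a cost linear in del. *)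
Lemma le_lin (A B K r : R) : 0 < r ->
  (forall del, 0 < del -> del <= r -> A <= B + K * del) -> A <= B.
Proof.
move=> r0 H; rewrite leNgt; apply/negP => BA.
pose del := Num.min r ((A - B) / (2 * (`|K| + 1))).
have K0 : 0 < 2 * (`|K| + 1) by rewrite mulr_gt0// ltr_wpDl.
have d0 : 0 < del by rewrite lt_min r0 divr_gt0// subr_gt0.
have dr : del <= r by rewrite ge_min lexx.
have d2 : del <= (A - B) / (2 * (`|K| + 1)) by rewrite ge_min lexx orbT.
have := H _ d0 dr; apply/negP; rewrite -ltNge.
rewrite ler_pdivlMr// in d2.
have h1 : K * del <= `|K| * del by rewrite ler_wpM2r ?ler_norm// ltW.
nra.
Qed.

Lemma avg_change lo hi i (s w s' w' al eps : R) : 0 < w -> 0 < w' ->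
  lo 0 i <= s -> lo 0 i <= s' -> s + w <= hi 0 i -> s' + w' <= hi 0 i ->
  (forall j, lo 0 j < hi 0 j) -> slack O lo hi ->
  (forall x, box lo hi x -> `|a i x - al| <= eps) ->
  `|avg (updrow lo i s) (updrow hi i (s + w)) - avg (updrow lo i s') (updrow hi i (s' + w'))
    + al * (s' - s)| <= eps * (hi 0 i - lo 0 i) + `|al| * (w + w').
Proof.
move=> w0 w0' h1 h2 h3 h4 lohi slk Ha.
have := @trapezoid_estimate _ _ _ leb O f (a i) i M mf (ma i) fM (aM i) (wfa i) lo hi s w s' w'
  w0 w0' h1 h2 h3 h4 (fun j => ltW (lohi j)) slk al eps Ha.
rewrite /avg !vol_updrow [s + w - s]addrC addKr [s' + w' - s']addrC addKr.
set V := \prod_(j < d | j != i) _; have V0 : 0 < V.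
  by apply: prodr_gt0 => j _; rewrite subr_gt0.
set I1 := Rintegral _ _ _; set I2 := Rintegral _ _ _ => H.
rewrite -(ler_pM2r V0); apply: le_trans H.
rewrite -[X in _ * X <= _](gtr0_norm V0) -normrM le_eqVlt; apply/orP; left; apply/eqP.
congr (`| _ |); field.
by rewrite !gt_eqF.
Qed.

(** One box is turned into the other one coordinate at a time; coordinate i costs M (q_i - p_i), by
    [avg_change] with al = 0 and eps = M. *)
Lemma avg_hull p q u u' v v' : slack O p q ->
  (forall j, p 0 j <= u 0 j /\ p 0 j <= v 0 j) ->
  (forall j, u' 0 j <= q 0 j /\ v' 0 j <= q 0 j) ->
  (forall j, u 0 j < u' 0 j /\ v 0 j < v' 0 j) ->
  `|avg u u' - avg v v'| <= M * \sum_(j < d) (q 0 j - p 0 j).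
Proof.
move=> slk Hp Hq Huv.
have pq j : p 0 j < q 0 j.
  by have [h1 _] := Hp j; have [h2 _] := Hq j; have [h3 _] := Huv j; lra.
pose mix (x y : 'rV[R]_d) n : 'rV[R]_d := \row_j (if (j < n)%N then y 0 j else x 0 j).
have mixd x y : mix x y d = y by apply/rowP => j; rewrite mxE ltn_ord.
have mix0 x y : mix x y 0 = x by apply/rowP => j; rewrite mxE.
suff H n : (n <= d)%N -> `|avg u u' - avg (mix u v n) (mix u' v' n)| <=
    M * \sum_(j < d | (j < n)%N) (q 0 j - p 0 j).
  have := H d (leqnn d); rewrite !mixd => /le_trans; apply.
  by apply: ler_wpM2l => //; rewrite le_eqVlt (eq_bigl xpredT) ?eqxx// => j; rewrite ltn_ord.
elim: n => [_|n IH nd].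
  by rewrite !mix0 subrr normr0 big1 ?mulr0// => j; rewrite ltn0.
pose i := Ordinal nd.
have step : `|avg (mix u v n) (mix u' v' n) - avg (mix u v n.+1) (mix u' v' n.+1)|
    <= M * (q 0 i - p 0 i).
  pose lo := updrow (mix u v n) i (p 0 i); pose hi := updrow (mix u' v' n) i (q 0 i).
  have E1 x y : mix x y n.+1 = updrow (mix x y n) i (y 0 i).
    apply/rowP => j; rewrite !mxE; case: eqVneq => [->|ji]; first by rewrite ltnS leqnn.
    by rewrite ltnS leq_eqVlt; case: eqP => // jn; case/eqP: ji; apply/val_inj.
  have E2 x y : mix x y n = updrow (mix x y n) i (x 0 i).
    by apply/rowP => j; rewrite !mxE; case: eqVneq => [->|//]; rewrite ltnn.
  have E3 x r1 r2 : updrow (updrow x i r1) i r2 = updrow x i r2.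
    by apply/rowP => j; rewrite !mxE; case: eqVneq.
  have [hp1 hp2] := Hp i; have [hq1 hq2] := Hq i; have [hu hv] := Huv i.
  have := @avg_change lo hi i (u 0 i) (u' 0 i - u 0 i) (v 0 i) (v' 0 i - v 0 i) 0 M.
  have E4 (r1 r2 : R) : r1 + (r2 - r1) = r2 by ring.
  rewrite !updrowE !subr_gt0 !E4 mul0r addr0 normr0 mul0r addr0 !E3.
  rewrite E1 [mix u' v' n.+1]E1 -(E2 u v) -(E2 u' v'); apply => //.
  - move=> j; rewrite !mxE; case: eqVneq => // _.
    by case: ifP => _; have [] := Huv j.
  - apply: (slack_sub slk) => j; rewrite !mxE; case: eqVneq => [->//|_].
      by case: ifP => _; have [] := Hp j.
    by case: ifP => _; have [] := Hq j.
  - by move=> x _; rewrite subr0; exact: aM.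
rewrite (bigD1 i)//= mulrDr.
apply: le_trans (ler_distD (avg (mix u v n) (mix u' v' n)) _ _) _.
rewrite addrC; apply: lerD => //; apply: le_trans (IH (ltnW nd)) _.
apply: ler_wpM2l => //; rewrite le_eqVlt; apply/orP; left; apply/eqP; apply: eq_bigl => j.
rewrite ltnS; apply/idP/idP => [jn|/andP[jn ji]].
  by rewrite (ltnW jn)/=; apply/eqP => ji; move: jn; rewrite ji ltnn.
by rewrite ltn_neqAle jn andbT; apply: contra ji => /eqP jn'; apply/eqP/val_inj.
Qed.

Lemma avg_norm p q : (forall j, p 0 j < q 0 j) -> `|avg p q| <= M.
Proof.
move=> pq; rewrite /avg normrM normfV (gtr0_norm (vol_gt0 pq)) ler_pdivrMr ?vol_gt0//.
apply: (Rintegral_box_le leb) => //; first by move=> j; exact: ltW.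
exact: measurable_funTS.
Qed.

(* The intervals centred at avg x (x + w) with radius M * sum w meet pairwise, by
   comparison with the smaller box of size min w w'. *)
Lemma avg_limit : exists g : 'rV[R]_d -> R, forall x (w : 'rV[R]_d), (forall j, 0 < w 0 j) ->
  slack O x (x + w) -> `|avg x (x + w) - g x| <= M * \sum_(j < d) w 0 j.
Proof.
pose S x := [set r : R | exists w : 'rV[R]_d, [/\ (forall j, 0 < w 0 j), slack O x (x + w) &
   r = avg x (x + w) - M * \sum_(j < d) w 0 j]].
have cmp x (w w' : 'rV[R]_d) : (forall j, 0 < w 0 j) -> (forall j, 0 < w' 0 j) ->
    slack O x (x + w) -> slack O x (x + w') ->
    avg x (x + w) - M * \sum_(j < d) w 0 j <= avg x (x + w') + M * \sum_(j < d) w' 0 j.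
  move=> w0 w0' sw sw'.
  pose m : 'rV[R]_d := \row_j Num.min (w 0 j) (w' 0 j).
  have H v : slack O x (x + v) -> (forall j, 0 < v 0 j) -> (forall j, m 0 j <= v 0 j) ->
      `|avg x (x + v) - avg x (x + m)| <= M * \sum_(j < d) v 0 j.
    move=> sv v0 mv; have := @avg_hull x (x + v) x (x + v) x (x + m) sv.
    rewrite (eq_bigr (fun j => v 0 j)); last by move=> j _; rewrite mxE addrAC subrr add0r.
    apply => j; split; rewrite ?mxE ?lerDl ?lerD2l ?ltrDl//.
      by have := mv j; rewrite !mxE.
    by rewrite lt_min w0 w0'.
  have := H w sw w0; have := H w' sw' w0'.
  move=> /(_ _)/wrap[j|]; first by rewrite mxE ge_min lexx orbT.
  move=> h1 /(_ _)/wrap[j|]; first by rewrite mxE ge_min lexx.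
  move=> h2; move: h1 h2; rewrite !ler_norml => /andP[h1 h2] /andP[h3 h4]; lra.
(* The supremum of the left endpoints lies in every interval, since each right endpoint bounds all
   the left ones. *)
exists (fun x => sup (S x)) => x w w0 sw.
have Sw : S x (avg x (x + w) - M * \sum_(j < d) w 0 j) by exists w.
have ub : ubound (S x) (avg x (x + w) + M * \sum_(j < d) w 0 j).
  by move=> r [w' [w0' sw' ->]]; exact: cmp.
have hs : has_sup (S x).
  by split; [exists (avg x (x + w) - M * \sum_(j < d) w 0 j)|
    exists (avg x (x + w) + M * \sum_(j < d) w 0 j)].
have h1 := sup_ubound hs.2 Sw.
have h2 := ge_sup hs.1 ub.
by rewrite ler_norml; apply/andP; split; lra.
Qed.


Section AverageLimit.
Variable g : 'rV[R]_d -> R.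
Hypothesis gE : forall x (w : 'rV[R]_d), (forall j, 0 < w 0 j) ->
  slack O x (x + w) -> `|avg x (x + w) - g x| <= M * \sum_(j < d) w 0 j.

Lemma avg_cube x (del : R) : 0 < del -> slack O x (x + const_mx del) ->
  `|avg x (x + const_mx del) - g x| <= M * d%:R * del.
Proof.
move=> d0 sx; have := gE (w := const_mx del) _ sx.
move=> /(_ (fun j => _))/wrap[j|]; first by rewrite mxE.
rewrite (eq_bigr (fun=> del)); last by move=> j _; rewrite mxE.
by rewrite sumr_const card_ord -mulrA mulr_natl.
Qed.

(** The cubes of side del at x and y lie in the box [p, q] enlarged by del, where [avg_hull]
    compares their averages. *)
Lemma avg_limit_lip p q x y : slack O p q ->
  (forall j, p 0 j <= x 0 j <= q 0 j) -> (forall j, p 0 j <= y 0 j <= q 0 j) ->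
  `|g x - g y| <= M * \sum_(j < d) (q 0 j - p 0 j).
Proof.
move=> slk Hx Hy; have [r r0 Hr] := slack_grow slk.
apply: (@le_lin _ _ (3 * (M * d%:R)) r r0) => del d0 dr.
have sq := Hr del (ltW d0) dr; set q' : 'rV[R]_d := \row_j _ in sq.
have sx (z : 'rV[R]_d) : (forall j, p 0 j <= z 0 j <= q 0 j) -> slack O z (z + const_mx del).
  move=> Hz; apply: (slack_sub sq) => j; have /andP[h1 h2] := Hz j => //.
  by rewrite !mxE lerD2r.
have h1 := avg_cube d0 (sx x Hx); have h2 := avg_cube d0 (sx y Hy).
have h3 : `|avg x (x + const_mx del) - avg y (y + const_mx del)| <=
    M * \sum_(j < d) (q 0 j - p 0 j) + M * d%:R * del.
  apply: (@le_trans _ _ (M * \sum_(j < d) (q' 0 j - p 0 j))).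
    apply: avg_hull => // j; have /andP[x1 x2] := Hx j; have /andP[y1 y2] := Hy j => //.
      by rewrite !mxE !lerD2r.
    by rewrite !mxE !ltrDl.
  rewrite -mulrA -mulrDr ler_wpM2l// mulr_natl -[d in _ *+ d]card_ord -sumr_const -big_split/=.
  by apply: ler_sum => j _; rewrite mxE; lra.
move: h1 h2 h3; rewrite !ler_norml => /andP[h1 h2] /andP[h3 h4] /andP[h5 h6].
by apply/andP; split; lra.
Qed.

(** The cube of side del at x and its translate by t along i span a box that is thin in the other
    coordinates; [avg_change] applies there, and del tends to 0. *)
Lemma avg_limit_incr x i t al eps : 0 < t -> slack O x (updrow x i (x 0 i + t)) ->
  (exists2 r : R, 0 < r & forall y, (forall j, x 0 j <= y 0 j <= (updrow x i (x 0 i + t)) 0 j + r) ->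
     `|a i y - al| <= eps) ->
  `|g (updrow x i (x 0 i + t)) - g x - al * t| <= eps * t.
Proof.
move=> t0 slk [r r0 Hr]; set y := updrow x i (x 0 i + t) in slk Hr *.
have [r' r0' Hr'] := slack_grow slk.
have rr : 0 < Num.min r r' by rewrite lt_min r0.
apply: (@le_lin _ _ (eps + 2 * `|al| + 2 * (M * d%:R)) _ rr) => del d0.
rewrite le_min => /andP[dr dr'].
have sq := Hr' del (ltW d0) dr'; set hi : 'rV[R]_d := \row_j _ in sq.
have yx j : x 0 j <= y 0 j by rewrite !mxE; case: eqVneq => [->|//]; rewrite lerDl ltW.
have sx : slack O x (x + const_mx del).
  by apply: (slack_sub sq) => j //; rewrite [(x + _) 0 j]mxE [const_mx _ _ _]mxE [hi 0 j]mxE lerD2r.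
have sy : slack O y (y + const_mx del).
  by apply: (slack_sub sq) => j //; rewrite [(y + _) 0 j]mxE [const_mx _ _ _]mxE [hi 0 j]mxE.
have h1 := avg_cube d0 sx; have h2 := avg_cube d0 sy.
have := @avg_change x hi i (x 0 i) del (x 0 i + t) del al eps d0 d0 (lexx _).
have Ehi : hi 0 i = x 0 i + t + del by rewrite mxE updrowE.
have E1 : updrow x i (x 0 i) = x by apply/rowP => j; rewrite !mxE; case: eqVneq => // ->.
have E2 : updrow hi i (x 0 i + del) = x + const_mx del.
  by apply/rowP => j; rewrite !mxE; case: eqVneq => // ->.
have E3 : updrow hi i (x 0 i + t + del) = y + const_mx del.
  by apply/rowP => j; rewrite !mxE; case: eqVneq.
rewrite Ehi E1 E2 E3 -/y lerDl (ltW t0) !lerD2r lerDl (ltW t0).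
have lohi j : x 0 j < hi 0 j.
  by rewrite [hi 0 j]mxE; have := yx j; lra.
have box_a (z : 'rV[R]_d) : box x hi z -> `|a i z - al| <= eps.
  move=> Hz; apply: Hr => j; have /andP[z1 z2] := Hz j; rewrite (ltW z1)/=.
  by move: z2; rewrite [hi 0 j]mxE => /le_trans; apply; rewrite lerD2l.
move=> /(_ isT isT (lexx _) lohi sq box_a) h3.
have h4 : al * (x 0 i + t - x 0 i) = al * t by ring.
have h5 : eps * (x 0 i + t + del - x 0 i) = eps * t + eps * del by ring.
rewrite h4 h5 in h3.
move: h1 h2 h3; rewrite !ler_norml => /andP[h1 h2] /andP[h3 h6] /andP[h7 h8].
by apply/andP; split; lra.
Qed.

Lemma avg_limit_continuous x : O x -> {for x, continuous g}.
Proof.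
move=> Ox; have [r r0 Hr] := slack_nbhs Ox.
apply/continuous_eps => eps e0.
have K0 : 0 < 2 * (M * d%:R) + 1 by rewrite ltr_wpDl// mulr_ge0// mulr_ge0.
(* The oscillation over a cube of half-side rho is at most 2 M d rho; the added 1 makes the
   denominator positive. *)
pose rho := Num.min r (eps / (2 * (M * d%:R) + 1)).
have rho0 : 0 < rho by rewrite lt_min r0 divr_gt0.
suff H y : (forall j, `|x 0 j - y 0 j| <= rho) -> `|g x - g y| <= eps.
  exists rho => // y /ltW xy; apply: H => j; apply: le_trans xy.
  by have := coord_le_norm (x - y) j; rewrite !mxE.
move=> xy.
pose p : 'rV[R]_d := \row_j (x 0 j - rho); pose q : 'rV[R]_d := \row_j (x 0 j + rho).
have rr : rho <= r by rewrite ge_min lexx.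
have slk : slack O p q by apply: Hr => j; rewrite mxE; lra.
apply: (le_trans (avg_limit_lip slk _ _)).
- by move=> j; rewrite !mxE; apply/andP; split; lra.
- by move=> j; rewrite !mxE; have := xy j; rewrite ler_norml => /andP[? ?]; apply/andP; split; lra.
rewrite (eq_bigr (fun=> 2 * rho)); last by move=> j _; rewrite !mxE; lra.
rewrite sumr_const card_ord.
have : rho <= eps / (2 * (M * d%:R) + 1) by rewrite ge_min lexx orbT.
rewrite ler_pdivlMr// => h; apply: le_trans h.
rewrite -[2 * rho *+ d]mulr_natl; nra.
Qed.

Lemma avg_limit_norm x : O x -> `|g x| <= M.
Proof.
move=> Ox; have [r r0 Hr] := slack_nbhs Ox.
apply: (@le_lin _ _ (M * d%:R) r r0) => del d0 dr.
have sx : slack O x (x + const_mx del).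
  by apply: Hr => j; rewrite ?mxE ?gerBl ?lerD2l ?(ltW r0)//= !mxE lerD2l.
have h1 := avg_cube d0 sx.
have h2 : `|avg x (x + const_mx del)| <= M.
  by apply: avg_norm => j; rewrite !mxE ltrDl.
move: h1 h2; rewrite !ler_norml => /andP[h1 h2] /andP[h3 h4].
by apply/andP; split; lra.
Qed.

Lemma avg_limit_derive x i : O x -> {for x, continuous (a i : 'rV[R]_d -> R)} ->
  is_derive x (ebasis R i) g (a i x).
Proof.
move=> Ox ca; have [r r0 Hr] := slack_nbhs Ox.
have shiftE y (t : R) : t *: ebasis R i + y = updrow y i (y 0 i + t).
  apply/rowP => j; rewrite !mxE eqxx /=; case: eqVneq => [->|_]; first by rewrite mulr1 addrC.
  by rewrite mulr0 add0r.
suff H : (fun h : R => h^-1 *: ((g \o shift x) (h *: ebasis R i) - g x)) @ 0^' --> a i x.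
  apply: DeriveDef; first by apply/cvg_ex; exists (a i x).
  exact/cvg_lim.
apply/cvgrPdist_le => /= eps e0.
have [rho rho0 Hrho] : exists2 rho : R, 0 < rho &
    forall y, (forall j, `|y 0 j - x 0 j| < rho) -> `|a i y - a i x| <= eps.
  have [rho rho0 Hb] := (continuous_eps _ _).1 ca eps e0.
  exists rho => // y Hy; rewrite distrC; apply: Hb; apply: norm_lt_coord => // j.
  by rewrite !mxE distrC.
(* The boxes used below reach at most 3 m from x: m for the base point, m for the increment, m for
   the room above. *)
pose m := Num.min r rho / 4.
have m0 : 0 < m by rewrite divr_gt0// lt_min r0.
have mr : m * 4 <= r by rewrite divfK// ge_min lexx.
have mrho : m * 4 <= rho by rewrite divfK// ge_min lexx orbT.
near=> t.
have tn0 : t != 0 by near: t; exact: nbhs_dnbhs_neq.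
have tm : `|t| <= m by near: t; apply: dnbhs0_le.
have key y (u : R) : 0 < u -> u <= m -> (forall j, x 0 j - m <= y 0 j) -> (forall j, y 0 j <= x 0 j + m) ->
    `|g (updrow y i (y 0 i + u)) - g y - a i x * u| <= eps * u.
  move=> u0 um y1 y2; apply: avg_limit_incr => //.
    apply: Hr => j; first by have := y1 j; lra.
    by rewrite mxE; have := y2 j; have := y2 i; case: eqVneq => [->|_]; lra.
  exists m => // z Hz; apply: Hrho => j.
  have /andP[z1 z2] := Hz j; rewrite mxE in z2; have h1 := y1 j; have h2 := y2 j.
  by rewrite ltr_norml; apply/andP; split; move: z2; case: eqVneq => [ji|_]; rewrite -?ji; lra.
have main : `|g (t *: ebasis R i + x) - g x - a i x * t| <= eps * `|t|.
  rewrite shiftE; have [tp|tneg|t0] := ltgtP t 0.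
  (* A negative increment is a positive one from the translated point back to x; this is why [key]
     allows any base point near x while keeping the slope at x. *)
  - have := key (updrow x i (x 0 i + t)) (- t); rewrite updrowE addrK.
    rewrite (_ : updrow (updrow _ _ _) _ _ = x); last first.
      by apply/rowP => j; rewrite !mxE; case: eqVneq => // ->.
    have Hm := tm; rewrite (ltr0_norm tp) in Hm *.
    rewrite oppr_gt0 => /(_ tp Hm) h.
    have -> : g (updrow x i (x 0 i + t)) - g x - a i x * t =
        - (g x - g (updrow x i (x 0 i + t)) - a i x * - t) by ring.
    rewrite normrN.
    apply: h => j; rewrite mxE; case: eqVneq => [->|_]; lra.
  - have Hm := tm; rewrite (gtr0_norm tneg) in Hm *.
    by apply: key => // j; lra.
  - by move: tn0; rewrite t0 eqxx.
rewrite /= -[a i x](mulKf tn0) -[t^-1 * _]/(t^-1 *: _) -scalerBr normrZ normfV.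
rewrite ler_pdivrMl ?normr_gt0// [`|t| * _]mulrC distrC [t * _]mulrC.
exact: main.
Unshelve. all: by end_near. Qed.

(** Both integrals are compared with g lo times the volume: that of f by the rate of convergence of
    averages, that of g by its Lipschitz bound. Each comparison contributes one M. *)
Lemma avg_limit_box lo hi : (forall j, lo 0 j < hi 0 j) -> slack O lo hi ->
  `|\int[mu]_(x in box lo hi) f x - \int[mu]_(x in box lo hi) g x| <=
   (\sum_(j < d) (M + M) * (hi 0 j - lo 0 j)) * vol lo hi.
Proof.
move=> lohi slk; set B := box lo hi; set W := \sum_(j < d) (hi 0 j - lo 0 j).
have V0 := vol_gt0 lohi.
have BO : B `<=` O.
  have [eta e0 HO] := slk => x Hx; apply: HO => j; have /andP[h1 h2] := Hx j.
  by rewrite (ltW h1)/= (le_trans h2)// lerDl ltW.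
have mgO := measurable_continuous_Rd oO avg_limit_continuous.
have mg : measurable_fun B g.
  apply: (measurable_funS _ BO) mgO; exact: open_measurable_Rd.
have h1 : `|\int[mu]_(x in B) f x - g lo * vol lo hi| <= M * W * vol lo hi.
  have lh : lo + (hi - lo) = hi by rewrite addrC subrK.
  have := gE (x := lo) (w := hi - lo); rewrite lh.
  rewrite (eq_bigr (fun j => hi 0 j - lo 0 j)); last by move=> j _; rewrite !mxE.
  move=> /(_ _ slk)/wrap[j|]; first by rewrite !mxE subr_gt0.
  rewrite -(ler_pM2r V0); apply: le_trans.
  by rewrite -[X in _ <= _ * X](gtr0_norm V0) -normrM /avg mulrBl divfK ?gt_eqF.
have gi : mu.-integrable B (EFin \o g).
  by apply: (integrable_box leb (M := M)) => // x /BO; exact: avg_limit_norm.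
have h2 : `|\int[mu]_(x in B) g x - g lo * vol lo hi| <= M * W * vol lo hi.
  have -> : g lo * vol lo hi = \int[mu]_(x in B) g lo.
    rewrite Rintegral_cst; last exact: measurable_box.
    by rewrite (mu_box leb)// => j; exact: ltW.
  rewrite -RintegralB//; [|exact: measurable_box|]; last first.
    apply: (integrable_box leb (M := `|g lo|)) => //.
  apply: (Rintegral_box_le leb) => //; first by move=> j; exact: ltW.
    exact: measurable_funB.
  move=> x Bx; apply: (avg_limit_lip slk) => j; first by have /andP[h ->] := Bx j; rewrite ltW.
  by rewrite lexx ltW.
rewrite -mulr_sumr -/W.
rewrite (_ : _ - _ = (\int[mu]_(x in B) f x - g lo * vol lo hi) -
  (\int[mu]_(x in B) g x - g lo * vol lo hi)); last by ring.
apply: le_trans (ler_normB _ _) _; lra.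
Qed.

End AverageLimit.
End BoxAverages.

(** * Functions with vanishing integrals over boxes *)

Section Bisection.
Variables (R : realType) (d : nat).
Implicit Types (lo hi : 'rV[R]_d).
Notation T := (Rd R d).
Variable mu : {measure set T -> \bar R}.
Hypothesis leb : is_lebesgue mu.
Variable O : set 'rV[R]_d.
Variables (h : T -> R) (C : R).
Hypotheses (mh : measurable_fun setT h) (hC : forall x, `|h x| <= C).

Let nu lo hi : R := \int[mu]_(x in box lo hi) h x.

Let hint lo hi : mu.-integrable (box lo hi) (EFin \o h).
Proof. by apply: (integrable_box leb (M := C)) => //; exact: measurable_funTS. Qed.

Lemma updrow_id (x : 'rV[R]_d) i : updrow x i (x 0 i) = x.
Proof. by apply/rowP => j; rewrite mxE; case: eqVneq => [->|]. Qed.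

Lemma box_split lo hi i (m : R) : lo 0 i <= m <= hi 0 i ->
  box lo hi = box lo (updrow hi i m) `|` box (updrow lo i m) hi /\
  [disjoint box lo (updrow hi i m) & box (updrow lo i m) hi].
Proof.
move=> /andP[lm mh']; split.
  apply/seteqP; split => [x Hx|x [] Hx j].
  - have [xm|mx] := leP ((x : 'rV[R]_d) 0 i) m.
      left=> j; rewrite mxE; have /andP[h1 h2] := Hx j; rewrite h1 /=.
      by case: eqVneq => [->|].
    right=> j; rewrite mxE; have /andP[h1 h2] := Hx j; rewrite h2 andbT.
    by case: eqVneq => [->|].
  - have := Hx j; rewrite mxE; case: eqVneq => [->|//] /andP[-> h2] /=.
    exact: le_trans h2 mh'.
  - have := Hx j; rewrite mxE; case: eqVneq => [->|//] /andP[h1 ->]; rewrite andbT.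
    exact: le_lt_trans lm h1.
apply/disj_setPS => x [/(_ i) + /(_ i)]; rewrite !updrowE => /andP[_ h1] /andP[h2 _].
by have := lt_le_trans h2 h1; rewrite ltxx.
Qed.

(* Cutting a box in two along coordinate i halves the coefficient K i, hence all
   the coefficients can be brought to 0. *)
Definition box_controlled (K : 'I_d -> R) := forall lo hi,
  (forall j, lo 0 j < hi 0 j) -> slack O lo hi ->
  `|nu lo hi| <= (\sum_(j < d) K j * (hi 0 j - lo 0 j)) * vol lo hi.

(** The two halves together have the volume of the box, so adding their bounds loses nothing and the
    halved side is a net gain. *)
Lemma box_controlled_halve K i : box_controlled K ->
  box_controlled (fun j => if j == i then K j / 2 else K j).
Proof.
move=> HK lo hi lohi slk.
pose m : R := (lo 0 i + hi 0 i) / 2.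
have li := lohi i.
have lm : lo 0 i < m by rewrite /m; lra.
have mhi : m < hi 0 i by rewrite /m; lra.
have [EB dB] : _ /\ _ := box_split (i := i) (m := m) (introT andP (conj (ltW lm) (ltW mhi))).
have nuE : nu lo hi = nu lo (updrow hi i m) + nu (updrow lo i m) hi.
  by rewrite /nu EB Rintegral_setU -?EB//; exact: measurable_box.
have V1 : vol lo (updrow hi i m) = vol lo hi / 2.
  rewrite -{1}(updrow_id lo i) vol_updrow (volD1 lo hi i) /m. by field.
have V2 : vol (updrow lo i m) hi = vol lo hi / 2.
  rewrite -{1}(updrow_id hi i) vol_updrow (volD1 lo hi i) /m. by field.
have h1 := HK lo (updrow hi i m); have h2 := HK (updrow lo i m) hi.
have S1 : \sum_j K j * ((updrow hi i m) 0 j - lo 0 j) =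
    \sum_j (if j == i then K j / 2 else K j) * (hi 0 j - lo 0 j).
  by apply: eq_bigr => j _; rewrite mxE; case: eqVneq => [->|//]; rewrite /m; field.
have S2 : \sum_j K j * (hi 0 j - (updrow lo i m) 0 j) =
    \sum_j (if j == i then K j / 2 else K j) * (hi 0 j - lo 0 j).
  by apply: eq_bigr => j _; rewrite mxE; case: eqVneq => [->|//]; rewrite /m; field.
rewrite V1 S1 in h1; rewrite V2 S2 in h2.
have {}h1 : `|nu lo (updrow hi i m)| <= (\sum_j (if j == i then K j / 2 else K j) * (hi 0 j - lo 0 j)) * (vol lo hi / 2).
  apply: h1 => [j|]; first by rewrite mxE; case: eqVneq => [->|].
  by apply: (slack_sub slk) => j //; rewrite mxE; case: eqVneq => [->|//]; exact: ltW.
have {}h2 : `|nu (updrow lo i m) hi| <= (\sum_j (if j == i then K j / 2 else K j) * (hi 0 j - lo 0 j)) * (vol lo hi / 2).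
  apply: h2 => [j|]; first by rewrite mxE; case: eqVneq => [->|].
  by apply: (slack_sub slk) => j //; rewrite mxE; case: eqVneq => [->|//]; exact: ltW.
rewrite nuE; apply: le_trans (ler_normD _ _) _; lra.
Qed.

Lemma box_controlled_erase K i : box_controlled K ->
  box_controlled (fun j => if j == i then 0 else K j).
Proof.
move=> HK.
have Hn n : box_controlled (fun j => if j == i then K j / 2 ^+ n else K j).
  elim: n => [|n IH].
    move=> lo hi lohi slk; apply: le_trans (HK lo hi lohi slk) _.
    rewrite le_eqVlt; apply/orP; left; apply/eqP; congr (_ * _).
    by apply: eq_bigr => j _; case: ifP => // _; rewrite expr0 divr1.
  move=> lo hi lohi slk; apply: le_trans (box_controlled_halve i IH lohi slk) _.
  rewrite le_eqVlt; apply/orP; left; apply/eqP; congr (_ * _).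
  apply: eq_bigr => j _; case: (j == i) => //; congr (_ * _).
  by rewrite exprSr invfM mulrA.
move=> lo hi lohi slk.
set S := (\sum_(j < d) _) * _.
pose E := `|K i| * (hi 0 i - lo 0 i) * vol lo hi.
apply/ler_addgt0Pr => eps e0.
have E0 : 0 <= E.
  by rewrite mulr_ge0 ?(ltW (vol_gt0 lohi))// mulr_ge0// subr_ge0 ltW.
have [n Hn'] : exists n : nat, E / 2 ^+ n <= eps.
  exists (Num.truncn (E / eps)).+1; rewrite ler_pdivrMr ?exprn_gt0//.
  rewrite -ler_pdivrMl// mulrC; have := truncnS_gt (E / eps) => /ltW /le_trans; apply.
  rewrite -natrX ler_nat; exact: ltnW (ltn_expl _ _).
apply: le_trans (Hn n lo hi lohi slk) _; apply: (@le_trans _ _ (S + E / 2 ^+ n)); last by rewrite lerD2l.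
rewrite /S /E (bigD1 i)//= [in leRHS](bigD1 i)//= eqxx mul0r add0r mulrDl addrC.
apply: lerD.
  rewrite le_eqVlt; apply/orP; left; apply/eqP; congr (_ * _).
  by apply: eq_bigr => j /negbTE ->.
rewrite [leRHS]mulrAC ler_wpM2r ?(ltW (vol_gt0 lohi))// [leRHS]mulrAC.
rewrite ler_wpM2r ?subr_ge0 ?(ltW (lohi i))// ler_pM2r ?invr_gt0 ?exprn_gt0//.
exact: ler_norm.
Qed.

Lemma box_integral_eq0 K : box_controlled K -> forall lo hi,
  (forall j, lo 0 j < hi 0 j) -> slack O lo hi -> nu lo hi = 0.
Proof.
move=> HK.
have H (s : seq 'I_d) : box_controlled (fun j => if j \in s then 0 else K j).
  elim: s => [//|i s IH] lo hi lohi slk.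
  apply: le_trans (box_controlled_erase i IH lohi slk) _.
  rewrite le_eqVlt; apply/orP; left; apply/eqP; congr (_ * _).
  by apply: eq_bigr => j _; rewrite inE; case: eqVneq.
move=> lo hi lohi slk; have := H (enum 'I_d) lo hi lohi slk.
rewrite big1 ?mul0r; last by move=> j _; rewrite mem_enum mul0r.
by rewrite normr_le0 => /eqP.
Qed.

End Bisection.

(** * Generation of the Borel sets by boxes *)

Section RationalBoxes.
Variables (R : realType) (d : nat).
Notation T := (Rd R d).

Definition ratbox (pq : 'rV[rat]_d * 'rV[rat]_d) : set T :=
  box (map_mx ratr pq.1 : 'rV[R]_d) (map_mx ratr pq.2).

Lemma ratbox_nbhs (O : set 'rV[R]_d) (x : 'rV[R]_d) : open O -> O x ->
  exists p q : 'rV[rat]_d, [/\ ratbox (p, q) (x : T),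
    (forall j, (map_mx ratr p : 'rV[R]_d) 0 j < (map_mx ratr q : 'rV[R]_d) 0 j) &
    slack O (map_mx ratr p : 'rV[R]_d) (map_mx ratr q)].
Proof.
move=> oO Ox; have [r r0 Hr] := slack_nbhs oO Ox.
have /choice[p Hp] j : exists q : rat, ratr q \in `](x 0 j - r), (x 0 j)[.
  by apply: rat_in_itvoo; lra.
have /choice[q Hq] j : exists q : rat, ratr q \in `](x 0 j), (x 0 j + r)[.
  by apply: rat_in_itvoo; lra.
exists (\row_j p j), (\row_j q j); split.
- move=> j; rewrite !mxE; have := Hp j; have := Hq j; rewrite !in_itv/=.
  by move=> /andP[h1 h2] /andP[h3 h4]; rewrite h4 ltW.
- move=> j; rewrite !mxE; have := Hp j; have := Hq j; rewrite !in_itv/=.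
  by move=> /andP[h1 h2] /andP[h3 h4]; exact: lt_trans h4 h1.
- by apply: Hr => j; rewrite !mxE; have := Hp j; have := Hq j; rewrite !in_itv/=;
    move=> /andP[h1 h2] /andP[h3 h4]; rewrite ltW.
Qed.

Lemma slack_sub_box (O : set 'rV[R]_d) lo hi : slack O lo hi ->
  forall x : T, box lo hi x -> O x.
Proof.
move=> [eta e0 HO] x Hx; apply: HO => j; have /andP[h1 h2] := Hx j.
by rewrite (ltW h1)/= (le_trans h2)// lerDl ltW.
Qed.

Definition boxes : set (set T) := [set A | exists a b : 'rV[R]_d, A = box a b].

(** An open set is the union of the rational boxes it contains, and these are countably many. In
    [F], codes of no such box are sent to the empty set. *)
Lemma measurable_boxesE : @measurable _ T = <<s boxes >>.
Proof.
apply/seteqP; split; last first.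
  apply: smallest_sub; first exact: sigma_algebra_measurable.
  by move=> _ [a [b ->]]; exact: measurable_box.
apply: smallest_sub; first exact: smallest_sigma_algebra.
move=> U oU.
pose F (n : nat) : set T := match @unpickle ('rV[rat]_d * 'rV[rat]_d)%type n with
  | Some pq => if `[< ratbox pq `<=` (U : set T) >] then ratbox pq else set0
  | None => set0 end.
have [S0 SC SU] := @smallest_sigma_algebra _ [set: T] boxes.
rewrite (_ : U = \bigcup_n F n); last first.
  apply/seteqP; split => [x Ux|x [n _]].
    have [p [q [xpq _ slk]]] := ratbox_nbhs oU Ux.
    exists (pickle (p, q)) => //; rewrite /F pickleK asboolT//.
    exact: (slack_sub_box slk).
  rewrite /F; case: unpickle => // pq; case: asboolP => // pqU; exact: pqU.
apply: SU => n; rewrite /F; case: unpickle => [pq|//].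
case: asboolP => // _.
by apply: sub_gen_smallest; exists (map_mx ratr pq.1), (map_mx ratr pq.2).
Qed.

End RationalBoxes.

Section ZeroOnBoxes.
Variables (R : realType) (d : nat).
Notation T := (Rd R d).
Variable mu : {measure set T -> \bar R}.
Hypothesis leb : is_lebesgue mu.
Variable O : set 'rV[R]_d.
Hypothesis oO : open O.
Variables (h : T -> R) (C : R).
Hypotheses (mh : measurable_fun setT h) (hC : forall x, `|h x| <= C).
Hypothesis h0 : forall lo hi : 'rV[R]_d, (forall j, lo 0 j < hi 0 j) -> slack O lo hi ->
  \int[mu]_(x in box lo hi) h x = 0.

(** The sets E with this property form a Dynkin system containing the boxes, and boxes are stable
    under intersection. *)
Lemma integral_measurable_eq0 (lo hi : 'rV[R]_d) : (forall j, lo 0 j < hi 0 j) -> slack O lo hi ->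
  forall E : set T, measurable E -> (\int[mu]_(x in box lo hi `&` E) (h x)%:E = 0)%E.
Proof.
move=> lohi slk E; set B := box lo hi.
have mB : measurable B by exact: measurable_box.
have hint : mu.-integrable B (EFin \o h).
  by apply: (integrable_box leb (M := C)) => //; exact: measurable_funTS.
have z0 (lo' hi' : 'rV[R]_d) : (forall j, lo' 0 j < hi' 0 j) -> slack O lo' hi' ->
    (\int[mu]_(x in box lo' hi') (h x)%:E = 0)%E.
  move=> l1 l2; have := h0 l1 l2; rewrite /Rintegral => e0.
  rewrite -[LHS]fineK ?e0//; apply: integrable_fin_num; first exact: measurable_box.
  by apply: (integrable_box leb (M := C)) => //; exact: measurable_funTS.
rewrite (measurable_boxesE R d); move: E; apply: (dynkin_induction (measurable_boxesE R d)).
- move=> _ _ [a [b ->]] [a' [b' ->]]; rewrite boxI; by do 2 eexists.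
- by rewrite setIT; exact: z0.
- move=> _ [a [b ->]]; rewrite boxI.
  set p := \row_i _; set q := \row_i _.
  have [pq|/existsNP[j /negP]] := pselect (forall j, p 0 j < q 0 j).
    by apply: z0 => //; apply: (slack_sub slk) => j; rewrite !mxE ?le_max ?ge_min lexx.
  by rewrite -leNgt => /box_empty ->; rewrite integral_set0.
- move=> S mS S0; have := integral_setU mu (A := B `&` S) (B := B `&` ~` S) (f := EFin \o h).
  rewrite -setIUr setUCr setIT z0// S0 add0e => <- //.
  + exact: measurableI.
  + by apply: measurableI => //; exact: measurableC.
  + by apply/measurable_EFinP; exact: measurable_funTS.
  + by apply/disj_setPS => x [[_ Sx] [_ nSx]]; exact: nSx.
- move=> F mF tF F0; rewrite setI_bigcupr integral_bigcup//.
  + by apply: eseries0 => n _ _; exact: F0.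
  + exact: trivIset_setIl.
  + by move=> n; exact: measurableI.
  + apply: integrableS hint => //; first by apply: bigcupT_measurable => n; exact: measurableI.
    by move=> x [n _ []].
Qed.

(** On the part where h > 0, and on its complement, the integral of |h| is that of h up to sign,
    hence zero. *)
Lemma ae_eq0_on_box (lo hi : 'rV[R]_d) : (forall j, lo 0 j < hi 0 j) -> slack O lo hi ->
  {ae mu, forall x : T, box lo hi x -> h x = 0}.
Proof.
move=> lohi slk; set B := box lo hi.
have mB : measurable B by exact: measurable_box.
pose E : set T := [set x | 0 < h x].
have mE : measurable E.
  rewrite (_ : E = h @^-1` `]0, +oo[%classic); last first.
    by apply/seteqP; split => x; rewrite /E /= in_itv/= andbT.
  by rewrite -[X in measurable X]setTI; exact: mh.
have Z := integral_measurable_eq0 lohi slk.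
have pos : {ae mu, forall x : T, (B `&` E) x -> (h x)%:E = 0%E}.
  apply/(ae_eq_integral_abs mu (measurableI _ _ mB mE)).
    by apply/measurable_EFinP; exact: measurable_funTS.
  rewrite -[RHS](Z E mE); apply: eq_integral => x; rewrite inE => -[_ hx].
  by rewrite abse_EFin gtr0_norm.
have neg : {ae mu, forall x : T, (B `&` ~` E) x -> (h x)%:E = 0%E}.
  apply/(ae_eq_integral_abs mu (measurableI _ _ mB (measurableC mE))).
    by apply/measurable_EFinP; exact: measurable_funTS.
  rewrite -[RHS]oppe0 -(Z (~` E) (measurableC mE)) -integralN.
    apply: eq_integral => x; rewrite inE => -[_ /negP hx].
    by rewrite abse_EFin -EFinN ler0_norm// leNgt.
  apply: fin_num_adde_defl.
  have hint : mu.-integrable (B `&` ~` E) (EFin \o h).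
    apply: (integrableS mB) => //.
    + by apply: measurableI => //; exact: measurableC.
    + by apply: (integrable_box leb (M := C)) => //; exact: measurable_funTS.
  have := integral_funeneg_lt_pinfty (measurableI _ _ mB (measurableC mE)) hint.
  by rewrite fin_numN ge0_fin_numE //; exact: integral_ge0.
apply: filterS2 pos neg => x px nx Bx.
by have [Ex|nEx] := pselect (E x); [have [] := px (conj Bx Ex)|have [] := nx (conj Bx nEx)].
Qed.

Lemma ae_eq0_on_open : {ae mu, forall x : T, O x -> h x = 0}.
Proof.
pose P (n : nat) (x : T) := match @unpickle ('rV[rat]_d * 'rV[rat]_d)%type n with
  | Some pq => (forall j, (map_mx ratr pq.1 : 'rV[R]_d) 0 j < (map_mx ratr pq.2 : 'rV[R]_d) 0 j) ->
      slack O (map_mx ratr pq.1 : 'rV[R]_d) (map_mx ratr pq.2) -> @ratbox R d pq x -> h x = 0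
  | None => True end.
have aeP n : {ae mu, forall x, P n x}.
  rewrite /P; case: unpickle => [pq|]; last by apply: aeW.
  have [lohi|nl] := pselect (forall j, (map_mx ratr pq.1 : 'rV[R]_d) 0 j < (map_mx ratr pq.2 : 'rV[R]_d) 0 j); last first.
    by apply: aeW => x /nl.
  have [slk|ns] := pselect (slack O (map_mx ratr pq.1 : 'rV[R]_d) (map_mx ratr pq.2)); last first.
    by apply: aeW => x _ /ns.
  by apply: filterS (ae_eq0_on_box lohi slk) => x Hx _ _; exact: Hx.
apply: filterS (ae_foralln aeP) => x Hx Ox.
have [p [q [xpq lohi slk]]] := ratbox_nbhs oO Ox.
by have := Hx (pickle (p, q)); rewrite /P pickleK; apply.
Qed.

End ZeroOnBoxes.

(** * Smooth representatives from smooth weak derivatives *)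

Section SmoothPrimitive.
Variables (R : realType) (d : nat).
Notation T := (Rd R d).
Variable mu : {measure set T -> \bar R}.
Hypothesis leb : is_lebesgue mu.
Variable O : set 'rV[R]_d.
Hypothesis oO : open O.

Let mO : measurable (O : set T). Proof. exact: open_measurable_Rd. Qed.

Lemma measurable_smooth (phi : 'rV[R]_d -> R) (l : seq 'I_d) (D : set T) :
  smooth_on setT phi -> measurable_fun D (pder l phi : T -> R).
Proof.
move=> sp; apply: measurable_funTS.
by apply: (@measurable_continuous_Rd _ _ setT) => [|x _]; [exact: openT|exact: (sp l).1].
Qed.

Lemma integral_restrict (u v : T -> R) :
  (\int[mu]_x ((u \_ O) x * v x)%:E = \int[mu]_(x in O) (u x * v x)%:E)%E.
Proof.
rewrite [RHS]integral_mkcond; apply: eq_integral => x _.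
by rewrite !patchE; case: ifP => // _; rewrite mul0r.
Qed.

Lemma smooth_of_weak_derivatives (f0 : T -> R) (a : 'I_d -> 'rV[R]_d -> R) (M1 : R) :
  Linf mu O f0 -> (forall n i, Cn (@ebasis R d) n O (a i)) ->
  (forall i x, O x -> `|a i x| <= M1) ->
  (forall phi, test_fun O phi -> forall i,
    (\int[mu]_(x in (O : set T)) (f0 x * 'D_(ebasis R i) phi x)%:E =
     - \int[mu]_(x in (O : set T)) (a i x * phi x)%:E)%E) ->
  exists g : 'rV[R]_d -> R, (forall n, Cn (@ebasis R d) n O g) /\
    {ae mu, forall x : T, O x -> f0 x = g x}.
Proof.
move=> [mf0 [M2 f0M]] Ca aM wf.
pose M := `|M1| + `|M2|.
have M1M : M1 <= M by rewrite /M (le_trans (ler_norm _))// lerDl.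
have M2M : M2 <= M by rewrite /M (le_trans (ler_norm _))// lerDr.
have M0 : 0 <= M by rewrite addr_ge0.
(* The bound on [f0] holds almost everywhere on O; cutting off outside S makes it hold everywhere
   and changes [f0] on O only on a null set. *)
pose S : set T := (O : set T) `&` f0 @^-1` `[- M, M]%classic.
have mS : measurable S by exact: mf0.
have SO : S `<=` (O : set T) by move=> x [].
pose f : T -> R := f0 \_ S.
pose b i : T -> R := (a i) \_ O.
have mf : measurable_fun setT f.
  by apply/(measurable_restrictT _ mS); exact: measurable_funS mf0.
have ca i x : O x -> {for x, continuous (a i)} by exact: (Cn_continuous (Ca 0%N i)).
have mb i : measurable_fun setT (b i).
  apply/(measurable_restrictT _ mO); exact: (measurable_continuous_Rd oO (ca i)).
have fM x : `|f x| <= M.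
  rewrite /f patchE; case: ifPn => [/set_mem[_]|_]; last by rewrite normr0.
  by rewrite /= in_itv/= -ler_norml.
have bM i x : `|b i x| <= M.
  rewrite /b patchE; case: ifPn => [/set_mem Ox|_]; last by rewrite normr0.
  exact: le_trans (aM i x Ox) M1M.
have ff0 : {ae mu, forall x : T, O x -> f x = f0 x}.
  apply: filterS f0M => x H Ox; rewrite /f patchE mem_set//; split => //.
  by rewrite /= in_itv/= -ler_norml (le_trans (H Ox)).
have wb i : weak_pd mu O f (b i) i.
  move=> phi tphi; rewrite integral_restrict -wf//.
  have fO : f = f \_ O.
    apply/funext => x; rewrite [RHS]patchE; case: ifPn => // /negP nO.
    by rewrite /f patchE; case: ifPn => // /set_mem[Ox _]; case: nO; rewrite inE.
  rewrite fO integral_restrict.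
  have mD : measurable_fun (O : set T) ('D_(ebasis R i) phi : T -> R).
    exact: (@measurable_smooth phi [:: i] O tphi.1).
  apply: ae_eq_integral => //.
  - by apply/measurable_EFinP; apply: measurable_funM => //; exact: measurable_funTS.
  - by apply/measurable_EFinP; exact: measurable_funM.
  - by apply: filterS ff0 => x H Ox; rewrite H.
have [g gE] := avg_limit leb mf mb fM bM wb.
have cg x : O x -> {for x, continuous g}.
  exact: (avg_limit_continuous leb oO mf mb fM bM wb gE).
have Cg n : Cn (@ebasis R d) n O g.
  (* One derivative suffices: the partial derivatives of g are the [a i], already of every class. *)
  case: n => [|n]; split => // i; exists (a i); split => // x Ox.
  have bx y : O y -> b i y = a i y by move=> Oy; rewrite /b patchE mem_set.
  rewrite -bx//; apply: (avg_limit_derive leb oO mf mb fM bM wb gE) => //.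
  apply: (continuous_eq_open oO Ox _ (ca i x Ox)) => y Oy; by rewrite bx.
exists g; split => //.
have gM x : O x -> `|g x| <= M by exact: (avg_limit_norm leb oO mf fM gE).
pose g' : T -> R := g \_ O.
have mg : measurable_fun (O : set T) (g : T -> R) := measurable_continuous_Rd oO cg.
have mg' : measurable_fun setT g' by apply/(measurable_restrictT _ mO).
have g'M x : `|g' x| <= M.
  by rewrite /g' patchE; case: ifPn => [/set_mem/gM//|_]; rewrite normr0.
pose h x := f x - g' x.
have mh : measurable_fun setT h by exact: measurable_funB.
have hC x : `|h x| <= M + M by apply: le_trans (ler_normB _ _) _; exact: lerD.
have bc : box_controlled mu O h (fun=> M + M).
  move=> lo hi lohi slk.
  have mB : measurable (box lo hi) by exact: measurable_box.
  have := avg_limit_box leb oO mf mb fM bM wb gE lohi slk.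
  have -> : \int[mu]_(x in box lo hi) g x = \int[mu]_(x in box lo hi) g' x.
    apply: eq_Rintegral => x; rewrite inE => /(slack_sub_box slk) Ox.
    by rewrite /g' patchE mem_set.
  rewrite -RintegralB//; apply: (integrable_box leb (M := M)) => //; exact: measurable_funTS.
have Z := box_integral_eq0 leb mh hC bc.
have := ae_eq0_on_open leb oO mh hC Z.
apply: filterS2 ff0 => x Hf Hh Ox.
rewrite -Hf//; have /eqP := Hh Ox; rewrite subr_eq0 => /eqP ->.
by rewrite /g' patchE mem_set.
Qed.

End SmoothPrimitive.

Unset Implicit Arguments.

Theorem mainTheorem14 (R : realType) (d k : nat)
  (mu : {measure set (Rd R d) -> \bar R}) (O : set 'rV[R]_d)
  (f : 'rV[R]_d -> 'rV[R]_d) (G : 'rV[R]_d -> 'M[R]_d) :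
  is_lebesgue mu ->
  (2 < d)%N -> open O ->
  (2 <= k <= d.-1)%N -> odd k ->
  W1inf_with_diff mu O f G ->
  (exists F : 'rV[R]_d -> 'M[R]_(dimext d k),
      [/\ smooth_on O F,
          (forall x, O x -> Htilde_gt (F x)) &
          {ae mu, forall x : Rd R d, O x -> F x = extpow k (G x)}]) ->
  exists g : 'rV[R]_d -> 'rV[R]_d,
    smooth_on O g /\ {ae mu, forall x : Rd R d, O x -> f x = g x}.
Proof.
move=> leb _ oO /andP[k1 _] ok [fL [GL wd]] [F [sF HF FG]].
have mO : measurable (O : set (Rd R d)) by exact: open_measurable_Rd.
have CF n p q : Cn (@ebasis R d) n O (fun x => F x p q) by exact: smooth_on_entry_Cn.
have /choice[B HB] : forall ij : 'I_d * 'I_d, exists M : R,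
    {ae mu, forall x : Rd R d, O x -> `|G x ij.1 ij.2| <= M}.
  by move=> [i j]; have [_] := GL i j.
pose M := \sum_ij `|B ij|.
have BM ij : B ij <= M.
  rewrite /M (bigD1 ij)//= (le_trans (ler_norm _))// lerDl.
  by apply: sumr_ge0.
have GM : {ae mu, forall x : Rd R d, O x -> forall i j, `|G x i j| <= M}.
  have H : {ae mu, forall x : Rd R d, forall ij : 'I_d * 'I_d, O x -> `|G x ij.1 ij.2| <= B ij}.
    exact: filter_forall.
  by apply: filterS H => x H Ox i j; apply: le_trans (H (i, j) Ox) (BM _).
have dense x W : O x -> open W -> W x -> exists y, [/\ W y, O y, F y = extpow k (G y) &
    forall i j, `|G y i j| <= M].
  move=> Ox oW Wx.
  have := ae_dense leb (filterI FG GM) (openI oW oO) (conj Wx Ox).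
  by move=> [y [[Wy Oy] [FGy GMy]]]; exists y; split; [|exact: Oy|exact: FGy|exact: GMy].
have root : forall x, O x -> exists A, extpow k A = F x /\ (k < \rank A)%N.
  apply: (compound_root_exists k1 CF HF (M := M)) => x W Ox oW Wx.
  by have [y [Wy _ Ey My]] := dense x W Ox oW Wx; exists y; split=> //; exists (G y).
have [A [CA AE]] := compound_root_smooth oO ok CF root.
(* Wherever [F x] is the compound of [G x], uniqueness of the root identifies [G x] with [A x]. *)
have GA : {ae mu, forall x : Rd R d, O x -> G x = A x}.
  by apply: filterS FG => x H Ox; apply: AE => //; rewrite H.
have AM i j x : O x -> `|A x i j| <= M.
  move=> Ox; rewrite leNgt; apply/negP => Mx.
  (* If |A i j| exceeded M at x, it would do so on an open set, which contains a point where A = G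
     and |G i j| <= M. Squares keep h within the closure properties of [Cn]. *)
  pose h x := (A x i j) * (A x i j) + - (M * M).
  have Ch n : Cn (@ebasis R d) n O h by apply: Cn_add; [exact: Cn_mul|exact: Cn_cst].
  have oW : open [set x | O x /\ 0 < h x] by apply: open_pos => // y; exact: (Cn_continuous (Ch 0%N)).
  have M0 : 0 <= M by apply: sumr_ge0.
  have hx : 0 < h x.
    rewrite /h subr_gt0 -!expr2 -[A x i j ^+ 2]real_normK ?num_real//.
    by rewrite ltr_pXn2r ?nnegrE.
  have [y [[Oy hy] _ Ey My]] := dense x _ Ox oW (conj Ox hx).
  move: hy; rewrite /h -(AE y (G y))// subr_gt0 -!expr2 -[G y i j ^+ 2]real_normK ?num_real//.
  by rewrite ltr_pXn2r ?nnegrE// ltNge My.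
have /choice[g Hg] : forall j : 'I_d, exists g : 'rV[R]_d -> R,
    (forall n, Cn (@ebasis R d) n O g) /\ {ae mu, forall x : Rd R d, O x -> f x 0 j = g x}.
  move=> j; apply: (smooth_of_weak_derivatives leb oO (a := fun i x => A x i j) (M1 := M)) => //.
    by move=> i x; exact: AM.
  (* The integral on the right does not see the null set where G differs from A, so A is also a weak
     differential of f. *)
  move=> phi tphi i; rewrite wd//; congr (- _)%E.
  have mphi := @measurable_smooth R d phi [::] O tphi.1.
  have mA : measurable_fun (O : set (Rd R d)) (fun x : Rd R d => A x i j).
    by apply: measurable_continuous_Rd => //; exact: (Cn_continuous (CA 0%N i j)).
  apply: ae_eq_integral => //.
  - by apply/measurable_EFinP; apply: measurable_funM => //; have [] := GL i j.
  - by apply/measurable_EFinP; exact: measurable_funM.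
  - by apply: filterS GA => x H Ox; rewrite H.
exists (fun x => \row_j g j x); split.
  apply: smooth_on_mx => // i j.
  rewrite (_ : (fun x => _) = g j); last by apply/funext => x; rewrite mxE.
  by apply: Cn_smooth_on => //; exact: (Hg j).1.
have H : {ae mu, forall x : Rd R d, forall j : 'I_d, O x -> f x 0 j = g j x}.
  by apply: filter_forall => j; exact: (Hg j).2.
by apply: filterS H => x H Ox; apply/rowP => j; rewrite mxE H.
Qed.
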